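(* Assume that $S\subseteq\omega_2$ is a stationary set such that (a) $\mathrm{cf}(\alpha)=\omega$ for every $\alpha\in S$, and (b) $S\cap\beta$ is not stationary in $\beta$ for every $\beta<\omega_2$ with $\mathrm{cf}(\beta)=\omega_1$. For every $\alpha\in S$ let $(p_n(\alpha))_{n<\omega}$ be a strictly increasing sequence of ordinals converging to $\alpha$, and put $A_\alpha=\{p_n(\alpha):n<\omega\}$ and $X=\bigcup_{\alpha\in S}A_\alpha$. Let $\mathfrak A$ be the algebra of subsets of $X$ generated by the finite subsets of $X$ together with the family $\{A_\alpha:\alpha\in S\}$, and let $K=\mathrm{ult}(\mathfrak A)$. Then $K$ is not Corson compact, while for every $Y\subseteq K$ with $|Y|\le\omega_1$ the closure $\overline Y$ is uniform Eberlein compact.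
   Context: For a limit ordinal $\gamma$, a set $F\subseteq\gamma$ is closed if it is closed in the interval (order) topology on $\gamma$, and unbounded if for every $\beta<\gamma$ there is $\alpha\in F$ with $\beta<\alpha$; $S\subseteq\gamma$ is stationary in $\gamma$ if $S\cap F\ne\emptyset$ for every closed unbounded $F\subseteq\gamma$. For a Boolean algebra $\mathfrak A$, $\mathrm{ult}(\mathfrak A)$ is its Stone space (of all ultrafilters on $\mathfrak A$). A compact (Hausdorff) space is Corson compact if for some $\kappa$ it is homeomorphic to a subset of $\Sigma(\mathbb R^\kappa)=\{x\in\mathbb R^\kappa: |\{\alpha: x_\alpha\ne0\}|\le\omega\}$ (with the topology inherited from the product $\mathbb R^\kappa$). A compact space is uniform Eberlein compact if it is homeomorphic to a weakly compact subset of a Hilbert space. *)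

(* Defs.v *)
From HB Require Import structures.
From mathcomp Require Import all_boot all_order all_algebra.
From mathcomp Require Import all_classical all_reals all_analysis.
Import Order.TTheory GRing.Theory Num.Theory.
Import numFieldNormedType.Exports.

Set Implicit Arguments.
Unset Strict Implicit.
Unset Printing Implicit Defensive.

Local Open Scope classical_set_scope.
Local Open Scope card_scope.

(* An ordinal is represented by any well-ordered type having that order type;
   an element [b] of such a type is the ordinal of its predecessors
   [predecessors b]. *)

(* If [U] is infinite, [T] has the order type of the initial ordinal |U|^+. *)
Definition is_successor_cardinal (U : Type) d (T : orderType d) : Prop :=
  [/\ wochoice.well_order (fun x y : T => (x <= y)%O),
      ~ ([set: T] #<= [set: U])
    & forall b : T, [set` `]-oo, b[ ] #<= [set: U]].

Definition is_omega1 d (T : orderType d) : Prop :=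
  is_successor_cardinal nat T.

Definition is_omega2 d1 (W1 : orderType d1) d (T : orderType d) : Prop :=
  is_omega1 W1 /\ is_successor_cardinal W1 T.

Definition predecessors d (T : orderType d) (b : T) : Type :=
  {x : T | (x < b)%O}.

HB.instance Definition _ d (T : orderType d) (b : T) :=
  SubChoice.on (predecessors b).
HB.instance Definition _ d (T : orderType d) (b : T) :=
  [SubChoice_isSubOrder of predecessors b by <: with d].

Definition unbounded d (T : orderType d) (F : set T) : Prop :=
  forall b : T, exists2 a : T, F a & (b < a)%O.

Definition stationary d (T : orderType d) (S : set T) : Prop :=
  forall F : set T,
    closed (F : set (order_topology T)) -> unbounded F -> S `&` F !=set0.

Definition cofinal_map d1 (L : orderType d1) (A : set L)
    d (T : orderType d) (b : T) (f : L -> T) : Prop :=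
  (forall l, A l -> (f l < b)%O) /\
  (forall x, (x < b)%O -> exists2 l, A l & (x <= f l)%O).

(* [L] is assumed well ordered: its order type is then the least ordinal with
   a cofinal, not necessarily monotone, map into [b]. *)
Definition has_cofinality d (T : orderType d) (b : T)
    d1 (L : orderType d1) : Prop :=
  (exists f : L -> T, cofinal_map setT b f) /\
  (forall (l : L) (f : L -> T), ~ cofinal_map [set` `]-oo, l[ ] b f).

Record field_of_sets (T : Type) (X : set T) (G : set_system T) : Prop := {
  field_sub : forall A, G A -> A `<=` X ;
  field_top : G X ;
  field_compl : forall A, G A -> G (X `\` A) ;
  field_setI : setI_closed G
}.

Definition generated_field (T : Type) (X : set T) (E : set_system T) :
  set_system T := smallest (field_of_sets X) E.

Record ultrafilter_of (T : Type) (X : set T) (G U : set_system T) : Prop := {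
  ult_sub : U `<=` G ;
  ult_top : U X ;
  ult_proper : ~ U set0 ;
  ult_setI : setI_closed U ;
  ult_up : forall A B, U A -> G B -> A `<=` B -> U B ;
  ult_compl : forall A, G A -> U A \/ U (X `\` A)
}.

Definition ult (T : Type) (X : set T) (G : set_system T) : Type :=
  {U : set_system T | ultrafilter_of X G U}.

HB.instance Definition _ T (X : set T) (G : set_system T) :=
  gen_eqMixin (ult X G).
HB.instance Definition _ T (X : set T) (G : set_system T) :=
  gen_choiceMixin (ult X G).
(* When [G] is a field of subsets of [X], these sets are closed under
   intersection, hence form the usual base of the Stone topology. *)
HB.instance Definition _ T (X : set T) (G : set_system T) :=
  isSubBaseTopological.Build (ult X G) G
    (fun A : set T => [set u : ult X G | sval u A]).

Definition homeomorphic (K L : topologicalType) : Prop :=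
  exists (f : K -> L) (g : L -> K),
    [/\ continuous f, continuous g, cancel f g & cancel g f].

Definition compact_hausdorff (K : topologicalType) : Prop :=
  compact [set: K] /\ hausdorff_space K.

Definition sigma_product (R : realType) (I : Type) : set {ptws I -> R} :=
  [set x | countable [set i | x i != 0%R]].

Definition corson_compact (R : realType) (K : topologicalType) : Prop :=
  compact_hausdorff K /\
  exists (I : Type) (E : set {ptws I -> R}),
    E `<=` @sigma_product R I /\ homeomorphic K E.

Definition is_hilbert (R : realType) (H : completeNormedModType R) : Prop :=
  exists dot : {dot H for @idfun R}%R,
    forall x : H, (`|x| ^+ 2 = dot x x)%R.

Definition dual (R : realType) (H : normedModType R) : Type :=
  {f : {scalar H} | continuous (f : H -> R)}.

(* [H] as a set, with the coarsest topology making every continuous linear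
   functional continuous instead of the norm topology. *)
Definition weak_space (R : realType) (H : normedModType R) : Type :=
  initial_topology
    (fun x : H => (fun f : dual H => sval f x) : {ptws dual H -> R}).

HB.instance Definition _ (R : realType) (H : normedModType R) :=
  Topological.on (weak_space H).

Definition uniform_eberlein_compact (R : realType) (K : topologicalType) :
    Prop :=
  compact_hausdorff K /\
  exists (H : completeNormedModType R) (E : set (weak_space H)),
    [/\ is_hilbert H, compact E & homeomorphic K E].

(* Main.v *)
Require Import Defs.
From HB Require Import structures.
From mathcomp Require Import all_boot all_order all_algebra finmap.
From mathcomp Require Import all_classical all_reals all_analysis.
From mathcomp.analysis.showcase Require Import summability.
From mathcomp Require Import ring lra.
Import Order.TTheory GRing.Theory Num.Theory.
Import numFieldNormedType.Exports.

(** The points of the Stone space [K] are the principal ultrafilters at the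
    elements of [X], one point for each ladder [A a] (the sets almost
    containing [A a]), to which the elements of [A a] converge, and one point
    at infinity, to which the points of the ladders converge.

    [K] is not Corson ([not_corson]). In a sigma-product, the point of each
    [a] in [S] differs from infinity at some coordinate, hence so does some
    element of the ladder of [a], which is smaller than [a]. This defines a
    regressive function on [S], one of whose fibers is uncountable
    ([pressing_down]). Countability of supports then yields a single
    coordinate and a single positive distance for infinitely many [a], against
    the convergence of the points of the ladders to infinity.

    Closures of small sets are uniform Eberlein ([closure_eberlein]). By
    induction on [b], the ladders of the elements of [S] up to [b] become
    pairwise disjoint once a finite set is removed from each
    ([disjointify_le]): for countable cofinality, cut the ladders along a
    cofinal sequence; for uncountable cofinality, cut them along a club of [b]
    disjoint from [S], which exists by non-reflection. A set of at most
    omega_1 points of [K] is controlled by some [b < omega_2], by regularity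
    ([omega2_regular]). On its closure, the singletons and the shortened
    ladders define clopen sets that separate points, each point being in at
    most two of them. Sending a point to the sum of the basis vectors of the
    clopen sets that contain it embeds the closure in the Hilbert space [ell2]
    with its weak topology ([eberlein_criterion]): only the fact that a
    continuous functional takes large values on finitely many basis vectors
    ([finite_big_functional]) is needed for continuity. *)

Set Implicit Arguments.
Unset Strict Implicit.
Unset Printing Implicit Defensive.

Local Open Scope classical_set_scope.
Local Open Scope card_scope.

#[local] Existing Instance totally_filter.

(** * The Hilbert space of square-summable families *)
Section ell2.
Local Open Scope ring_scope.
Context {R : realType} {I : choiceType}.
Implicit Types (x y z : I -> R) (A B : {fset I}).

(** The partial inner product of two families, over the finite index set
    [A]. *)
Definition fdot x y A : R := \sum_(i <- A) x i * y i.

Lemma fdot_ge0 x A : 0 <= fdot x x A.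
Proof. by apply: sumr_ge0 => i _; rewrite -expr2 sqr_ge0. Qed.

Lemma fdotC x y A : fdot x y A = fdot y x A.
Proof. by apply: eq_bigr => i _; rewrite mulrC. Qed.

Lemma fdotDl x y z A : fdot (x + y) z A = fdot x z A + fdot y z A.
Proof. by rewrite -big_split; apply: eq_bigr => i _ /=; rewrite -mulrDl. Qed.

Lemma fdotZl (a : R) x y A : fdot (a *: x) y A = a * fdot x y A.
Proof. by rewrite /fdot mulr_sumr; apply: eq_bigr => i _; rewrite mulrA. Qed.

Lemma le_fdot x A B : (A `<=` B)%fset -> fdot x x A <= fdot x x B.
Proof.
move=> AB; pose g i := if i \in A then x i * x i else 0.
have -> : fdot x x A = \sum_(i <- A) g i.
  by apply: eq_big_seq => i iA; rewrite /g iA.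
rewrite (big_fset_incl _ AB)//.
  apply: ler_sum => i _; rewrite /g; case: ifP => // _.
  by rewrite -expr2 sqr_ge0.
by move=> i _ /negbTE iA; rewrite /g iA.
Qed.

(** Square summability is stated through bounded partial sums, so that no
    infinite sum is needed to define the space. *)
Definition square_summable : set (I -> R) :=
  [set x | exists M, forall A, fdot x x A <= M].

(** Polarization: it reduces the convergence of inner products to that of sums
    of squares, which is a matter of monotone boundedness. *)
Lemma fdot_polar x y A :
  fdot x y A = 2^-1 * (fdot (x + y) (x + y) A - fdot x x A - fdot y y A).
Proof.
rewrite fdotDl ![fdot _ (x + y) A]fdotC !fdotDl [fdot y x A]fdotC.
by field.
Qed.

Lemma square_summableP (a : R) x y : square_summable x -> square_summable y ->
  square_summable (a *: x + y).
Proof.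
move=> [M xM] [N yN]; exists (2 * (a ^+ 2 * M) + 2 * N) => A.
apply: (@le_trans _ _ (2 * (a ^+ 2 * fdot x x A) + 2 * fdot y y A)).
  rewrite /fdot !mulr_sumr -big_split /=; apply: ler_sum => i _.
  have -> : (a *: x + y) i = a * x i + y i by [].
  have := sqr_ge0 (a * x i - y i); nra.
by apply: lerD; rewrite ler_wpM2l// ler_wpM2l// sqr_ge0.
Qed.

Lemma square_summable0 : square_summable 0.
Proof. by exists 0 => A; rewrite /fdot big1// => i _; rewrite mulr0. Qed.

Lemma is_cvg_fdotxx x : square_summable x -> cvg (fdot x x @ totally).
Proof.
move=> [M xM]; apply/cvg_ex; exists (sup (range (fdot x x))).
have hs : has_sup (range (fdot x x)).
  by split; [exists (fdot x x fset0); exists fset0 | exists M => _ [A _ <-]].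
apply/cvgrPdist_le => /= e e0.
have [_ [A _ <-] Ae] := sup_adherent e0 hs.
exists A => // B /= AB.
rewrite ger0_norm ?subr_ge0; last by apply: sup_ubound; [case: hs|exists B].
by rewrite lerBlDr -lerBlDl (le_trans (ltW Ae))// le_fdot.
Qed.

Lemma is_cvg_fdot x y : square_summable x -> square_summable y ->
  cvg (fdot x y @ totally).
Proof.
move=> xs ys; have -> : fdot x y = fun A => 2^-1 *
    (fdot (x + y) (x + y) A - fdot x x A - fdot y y A).
  by apply/funext => A; exact: fdot_polar.
have xy : square_summable (x + y).
  by rewrite -[x]scale1r; exact: square_summableP.
apply: is_cvgM; first exact: is_cvg_cst.
by apply: is_cvgB; [apply: is_cvgB|]; exact: is_cvg_fdotxx.
Qed.

Definition ell2_pred : {pred I -> R} := mem square_summable.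

Lemma ell2_submod_closed : submod_closed ell2_pred.
Proof.
split; first by rewrite inE; exact: square_summable0.
by move=> a x y; rewrite !inE; exact: square_summableP.
Qed.

HB.instance Definition _ :=
  GRing.isSubmodClosed.Build _ _ ell2_pred ell2_submod_closed.

(** The Hilbert space of square-summable real families indexed by an
    arbitrary, possibly uncountable, type [I]. *)
Record ell2 := Ell2 { ell2_val :> I -> R ; _ : ell2_val \in ell2_pred }.

HB.instance Definition _ := [isSub for ell2_val].
HB.instance Definition _ := [Choice of ell2 by <:].
HB.instance Definition _ := [SubChoice_isSubLmodule of ell2 by <:].

Lemma ell2P (u : ell2) : square_summable u.
Proof. by have /set_mem := valP u. Qed.

(** The inner product is the limit of [fdot u v] along the finite subsets of
    [I] ordered by inclusion; its bilinearity follows from that of [fdot]. *)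
Definition dot2 (u v : ell2) : R := lim (fdot u v @ totally).

Lemma dot2_cvg (u v : ell2) : fdot u v @ totally --> dot2 u v.
Proof. by apply: is_cvg_fdot; exact: ell2P. Qed.

Lemma dot2E (u v : ell2) (l : R) : fdot u v @ totally --> l -> dot2 u v = l.
Proof. exact: (cvg_unique _ (@dot2_cvg u v)). Qed.

Lemma dot2C u v : dot2 u v = dot2 v u.
Proof.
apply: dot2E; have -> : fdot u v = fdot v u by apply/funext => A; exact: fdotC.
exact: dot2_cvg.
Qed.

Lemma dot2Pl (a : R) (u v w : ell2) :
  dot2 (a *: u + v) w = a * dot2 u w + dot2 v w.
Proof.
apply: dot2E.
have -> : fdot (a *: u + v : ell2) w = (fun A => a * fdot u w A + fdot v w A).
  apply/funext => A; rewrite -fdotZl -fdotDl.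
  by congr fdot; rewrite !GRing.valD GRing.valZ.
by apply: cvgD; [apply: cvgM; [exact: cvg_cst|]|]; exact: dot2_cvg.
Qed.

Lemma dot2Pr (a : R) (u v w : ell2) :
  dot2 w (a *: u + v) = a * dot2 w u + dot2 w v.
Proof. by rewrite dot2C dot2Pl ![dot2 _ w]dot2C. Qed.

Lemma fdot_le_dot2 (u : ell2) A : fdot u u A <= dot2 u u.
Proof.
apply: limr_ge; first exact: dot2_cvg.
by exists A => // B /=; exact: le_fdot.
Qed.

Lemma dot2_le (u : ell2) (M : R) : (forall A, fdot u u A <= M) -> dot2 u u <= M.
Proof.
move=> uM; apply: limr_le; first exact: dot2_cvg.
by exists fset0 => // B _ /=; exact: uM.
Qed.

Lemma dot2_ge0 (u : ell2) : 0 <= dot2 u u.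
Proof. by apply: le_trans (fdot_le_dot2 u fset0); exact: fdot_ge0. Qed.

Lemma coord_le (u : ell2) i : u i ^+ 2 <= dot2 u u.
Proof.
by apply: le_trans (fdot_le_dot2 u [fset i]%fset); rewrite /fdot big_seq_fset1.
Qed.

Lemma dot2_eq0 (u : ell2) : dot2 u u = 0 -> u = 0.
Proof.
move=> u0; apply: val_inj; apply/funext => i /=.
have := coord_le u i; rewrite u0 => ui.
have : u i ^+ 2 == 0 by rewrite eq_le ui sqr_ge0.
by rewrite sqrf_eq0 => /eqP ->.
Qed.

Definition norm2 (u : ell2) : R := Num.sqrt (dot2 u u).

Lemma norm2_sqr u : norm2 u ^+ 2 = dot2 u u.
Proof. by rewrite sqr_sqrtr// dot2_ge0. Qed.

Lemma norm2_ge0 u : 0 <= norm2 u. Proof. exact: sqrtr_ge0. Qed.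

Lemma norm2_eq0 u : norm2 u = 0 -> u = 0.
Proof. by move=> u0; apply: dot2_eq0; rewrite -norm2_sqr u0 expr0n. Qed.

Lemma dot2Dl u v w : dot2 (u + v) w = dot2 u w + dot2 v w.
Proof. by rewrite -{1}[u]scale1r dot2Pl mul1r. Qed.

Lemma dot2Dr u v w : dot2 w (u + v) = dot2 w u + dot2 w v.
Proof. by rewrite dot2C dot2Dl ![dot2 _ w]dot2C. Qed.

Lemma dot20l u : dot2 0 u = 0.
Proof.
by apply: (addIr (dot2 0 u)); rewrite add0r -dot2Dl addr0.
Qed.

Lemma dot2Zl a u v : dot2 (a *: u) v = a * dot2 u v.
Proof. by rewrite -[a *: u]addr0 dot2Pl dot20l addr0. Qed.

Lemma dot2Zr a u v : dot2 v (a *: u) = a * dot2 v u.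
Proof. by rewrite dot2C dot2Zl dot2C. Qed.

Lemma dot2_CauchySchwarz u v : dot2 u v <= norm2 u * norm2 v.
Proof.
have [u0|u0] := eqVneq (norm2 u) 0.
  by rewrite (norm2_eq0 u0) dot20l mulr_ge0// norm2_ge0.
have [v0|v0] := eqVneq (norm2 v) 0.
  by rewrite (norm2_eq0 v0) dot2C dot20l mulr_ge0// norm2_ge0.
have up : 0 < norm2 u by rewrite lt_neqAle eq_sym u0 norm2_ge0.
have vp : 0 < norm2 v by rewrite lt_neqAle eq_sym v0 norm2_ge0.
have := dot2_ge0 (norm2 v *: u + (- norm2 u) *: v).
rewrite dot2Pl dot2Dr !dot2Zr dot2Zl dot2Dr !dot2Zr [dot2 v u]dot2C.
rewrite -!norm2_sqr => h.
have uv : 0 < norm2 u * norm2 v by rewrite mulr_gt0.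
rewrite -(ler_pM2l uv); nra.
Qed.

Lemma norm2D u v : norm2 (u + v) <= norm2 u + norm2 v.
Proof.
rewrite -(@ler_pXn2r _ 2)// ?nnegrE ?addr_ge0 ?norm2_ge0//.
rewrite norm2_sqr dot2Dl !dot2Dr [dot2 v u]dot2C sqrrD !norm2_sqr.
by have := dot2_CauchySchwarz u v; lra.
Qed.

Lemma norm2Z (a : R) u : norm2 (a *: u) = `|a| * norm2 u.
Proof.
by rewrite /norm2 dot2Zl dot2Zr mulrA -expr2 sqrtrM ?sqr_ge0// sqrtr_sqr.
Qed.

HB.instance Definition _ :=
  Lmodule_isNormed.Build R ell2 norm2D norm2Z norm2_eq0.

Lemma ell2_normE (u : ell2) : `|u| = norm2 u. Proof. by []. Qed.

Lemma ell2_coord_le (u : ell2) i : `|u i| <= `|u|.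
Proof.
rewrite -(@ler_pXn2r _ 2)// ?nnegrE ?norm2_ge0//.
by rewrite ell2_normE norm2_sqr real_normK ?num_real// coord_le.
Qed.

Lemma ell2_subE (u v : ell2) i : (u - v) i = u i - v i.
Proof. by have -> : val (u - v) = val u - val v by rewrite GRing.valB. Qed.

(** The limit of a Cauchy filter is its coordinatewise limit [l]: every
    partial sum of squares of [u - l] is a limit of partial sums for [u - v],
    with [v] close to [u], which gives both the membership of [l] and the
    convergence in norm. *)
Lemma ell2_complete (F : set_system ell2) : ProperFilter F -> cauchy F -> cvg F.
Proof.
move=> FF /cauchyP Fc.
have coord_cvg i : cvg ((fun u : ell2 => u i) @ F).
  apply: R_complete; apply/cauchyP => e e0.
  have [u Fu] := Fc e e0; exists (u i).
  change (F ((fun v : ell2 => v i) @^-1` ball (u i) e)).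
  apply: filterS Fu => v /=.
  rewrite -!ball_normE /= => uv; apply: le_lt_trans uv.
  by have := ell2_coord_le (u - v) i; rewrite ell2_subE.
pose l i := lim ((fun u : ell2 => u i) @ F).
have near_l (e : R) (u0 : ell2) : 0 < e -> F (ball u0 e) ->
    forall u : ell2, ball u0 e u ->
    forall A, fdot (val u - l) (val u - l) A <= (2 * e) ^+ 2.
  move=> e0 Fu0 u; rewrite -ball_normE /= => u0u A.
  have fE : (fun v : ell2 => fdot (val u - val v) (val u - val v) A) @ F -->
            fdot (val u - l) (val u - l) A.
    rewrite /fdot.
    apply: cvg_big => [|i _]; first exact: add_continuous.
    by apply: cvgM; apply: cvgB; first [exact: cvg_cst|exact: coord_cvg].
  have <- := cvg_lim _ fE; last exact: Rhausdorff.
  apply: limr_le; first by apply/cvg_ex; eexists; exact: fE.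
  apply: filterS Fu0 => v; rewrite -ball_normE /= => u0v.
  rewrite -GRing.valB (le_trans (fdot_le_dot2 _ _))// -norm2_sqr.
  rewrite ler_pXn2r// ?nnegrE ?norm2_ge0//; last lra.
  have -> : u - v = (u0 - v) - (u0 - u) by rewrite opprB [RHS]addrC addrA subrK.
  rewrite -ell2_normE (le_trans (ler_normB _ _))//; lra.
have l2 : square_summable l.
  have [u Fu] := Fc 1 ltr01.
  have h : square_summable (val u - l).
    by exists ((2 * 1) ^+ 2); apply: (near_l 1 u) => //; exact: ballxx.
  have -> : l = (-1 : R) *: (val u - l) + val u.
    by rewrite scaleN1r opprB subrK.
  by apply: square_summableP => //; exact: ell2P.
have lP : l \in ell2_pred by rewrite inE.
apply/cvg_ex; exists (Ell2 lP); apply/cvgrPdist_le => /= e e0.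
have e2 : 0 < e / 2 by lra.
have [u Fu] := Fc _ e2.
apply: filterS (Fu) => v uv; rewrite distrC ell2_normE.
rewrite -(@ler_pXn2r _ 2)// ?nnegrE ?norm2_ge0//; last lra.
rewrite norm2_sqr; apply: dot2_le => A; rewrite GRing.valB /=.
have := near_l _ _ e2 Fu _ uv A.
by rewrite mulrCA divff ?mulr1.
Qed.

HB.instance Definition _ := Uniform_isComplete.Build ell2 ell2_complete.

HB.instance Definition _ := @bilinear_isBilinear.Build R ell2 ell2 R
  (GRing.Scale.Law.clone R R ( *%R ) _)
  (GRing.Scale.Law.clone R R (idfun \; *%R ) _) dot2
  (conj (fun w a u v => dot2Pl a u v w) (fun w a u v => dot2Pr a u v w)).

Lemma dot2_hermitian (u v : ell2) : dot2 u v = (-1) ^+ false * idfun (dot2 v u).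
Proof. by rewrite expr0 mul1r /= dot2C. Qed.

HB.instance Definition _ :=
  @isHermitianSesquilinear.Build R ell2 false idfun dot2 dot2_hermitian.

Lemma dot2_gt0 (u : ell2) : u != 0 -> 0 < dot2 u u.
Proof.
move=> u0; rewrite lt_neqAle dot2_ge0 andbT eq_sym.
by apply: contraNneq u0 => /dot2_eq0 ->.
Qed.

HB.instance Definition _ := @isDotProduct.Build R ell2 dot2 dot2_gt0.

End ell2.

Section ell2_basis.
Local Open Scope ring_scope.
Context {R : realType} {I : choiceType}.
Local Notation H := (@ell2 R I).
Implicit Types (u v : H) (i j : I) (A : {fset I}).

Lemma ell2_hilbert : is_hilbert H.
Proof.
exists (@dot2 R I : {dot H for @idfun R}) => u.
by rewrite ell2_normE norm2_sqr.
Qed.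

Let basis_fun i : I -> R := fun j => (j == i)%:R.

Lemma basis_in_ell2 i : basis_fun i \in ell2_pred.
Proof.
rewrite inE; exists 1 => A; rewrite /fdot.
under eq_bigr do rewrite /basis_fun -natrM mulnb andbb.
have [iA|iA] := boolP (i \in A).
  rewrite (big_fsetD1 _ iA) /= eqxx big1_fset ?addr0// => j.
  by rewrite !inE => /andP[/negbTE -> _].
rewrite big1_fset// => j jA _.
by case: eqVneq => // ji; move: iA; rewrite -ji jA.
Qed.

(** The canonical orthonormal basis. *)
Definition ebasis i : H := Ell2 (basis_in_ell2 i).

Lemma ebasisE i j : ebasis i j = (j == i)%:R. Proof. by []. Qed.

Lemma dot2_ebasis i u : dot2 (ebasis i) u = u i.
Proof.
apply: dot2E; apply: cvg_near_cst; exists [fset i]%fset => // A /= iA.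
have -> : fdot (ebasis i) u A = \sum_(j <- A) (j == i)%:R * u j by [].
rewrite (big_fsetD1 i) /=; last by apply: (fsubsetP iA); rewrite inE.
rewrite eqxx mul1r big1_fset ?addr0// => j.
by rewrite !inE => /andP[/negbTE ji _ _]; rewrite ji mul0r.
Qed.

Lemma dot2_suml (r : seq I) (F : I -> H) u :
  dot2 (\sum_(i <- r) F i) u = \sum_(i <- r) dot2 (F i) u.
Proof. exact: (big_morph (dot2^~ u) (fun v w => dot2Dl v w u) (dot20l u)). Qed.

Lemma sum_ebasisE A (g : I -> R) j :
  (\sum_(i <- A) g i *: ebasis i) j = if j \in A then g j else 0.
Proof.
rewrite -dot2_ebasis dot2C dot2_suml.
under eq_bigr do rewrite dot2Zl dot2_ebasis ebasisE.
case: ifPn => jA.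
  rewrite (big_fsetD1 _ jA) /= eqxx mulr1 big1_fset ?addr0// => i.
  by rewrite !inE => /andP[/negbTE ij _ _]; rewrite ij mulr0.
rewrite big1_fset// => i iA _; case: eqVneq; rewrite ?mulr0// => ij.
by move: jA; rewrite -ij iA.
Qed.

(** Bessel inequality for a continuous functional, with no appeal to the Riesz
    representation: test [f] on the vectors whose coordinates are the values
    [f (ebasis i)] for [i] in a finite set. *)
Lemma bessel_functional (f : {scalar H}) : continuous (f : H -> R) ->
  square_summable (fun i => f (ebasis i)).
Proof.
move=> fc; have f0 : f 0 = 0 by rewrite linear0.
have /cvgrPdist_lt/(_ 1 ltr01)/nbhs_norm0P[d /= d0 fd] := fc 0.
exists ((2 / d) ^+ 2) => A; set g := fun i => f (ebasis i).
pose w : H := \sum_(i <- A) g i *: ebasis i.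
have fw : f w = fdot g g A.
  by rewrite /w linear_sum; apply: eq_bigr => i _; rewrite linearZ.
have ww : dot2 w w = fdot g g A.
  rewrite {1}/w dot2_suml; apply: eq_big_seq => i iA.
  by rewrite dot2Zl dot2_ebasis sum_ebasisE iA.
rewrite -fw in ww; rewrite -fw -ww -norm2_sqr -ell2_normE.
have [->|w0] := eqVneq w 0; first by rewrite normr0 expr0n sqr_ge0.
have wp : 0 < `|w| by rewrite normr_gt0.
rewrite ler_pXn2r ?nnegrE ?divr_ge0 ?(ltW d0)//.
pose t := d / (2 * `|w|).
have t0 : 0 < t by rewrite divr_gt0// mulr_gt0.
have tw : `|t *: w| < d.
  rewrite normrZ gtr0_norm// (_ : t * `|w| = d / 2); first lra.
  by rewrite /t; field; rewrite gt_eqF.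
have := fd (t *: w) tw.
rewrite /= f0 sub0r normrN linearZ /= -ww -norm2_sqr -ell2_normE.
have -> : t * `|w| ^+ 2 = d / 2 * `|w| by rewrite /t; field; rewrite gt_eqF.
rewrite ger0_norm; last by rewrite mulr_ge0// ltW// divr_gt0.
move=> h; rewrite ler_pdivlMr//; nra.
Qed.

Lemma finite_big_functional (f : {scalar H}) (e : R) :
  continuous (f : H -> R) -> 0 < e ->
  finite_set [set i | e <= `|f (ebasis i)|].
Proof.
move=> fc e0; have [M fM] := bessel_functional fc.
apply: contrapT => inf.
have [A Asub nA] := infinite_set_fset (Num.Def.truncn (M / e ^+ 2)).+1 inf.
have e2 : 0 < e ^+ 2 by rewrite exprn_gt0.
have : (#|` A|)%:R * e ^+ 2 <= M.
  apply: le_trans (fM A); rewrite /fdot mulr_natl.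
  have -> : e ^+ 2 *+ #|` A| = \sum_(i <- A) e ^+ 2.
    by rewrite big_const_seq count_predT iter_addr_0.
  rewrite big_seq [leRHS]big_seq; apply: ler_sum => i iA.
  rewrite -expr2 -[leRHS]real_normK ?num_real//.
  by rewrite ler_pXn2r ?nnegrE ?(ltW e0)//; exact: Asub.
rewrite -ler_pdivlMr// => h.
have := truncnS_gt (M / e ^+ 2); rewrite ltNge (le_trans _ h)//.
by rewrite ler_nat.
Qed.

End ell2_basis.

(** * Criteria for continuity, separation and homeomorphism *)
Section topology_lemmas.

Lemma continuous_to_initial (T : topologicalType) (S : choiceType)
    (U : topologicalType) (f : S -> U) (g : T -> initial_topology f) :
  continuous ((f : initial_topology f -> U) \o g) -> continuous g.
Proof.
move=> /continuousP fg; apply/continuousP => A [B oB <-].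
exact: (fg B oB).
Qed.

Lemma continuous_to_ptws (T : topologicalType) (I : Type) (V : topologicalType)
    (g : T -> {ptws I -> V}) :
  (forall i, continuous (fun t => g t i)) -> continuous g.
Proof.
move=> gc t; apply/cvg_sup => i.
apply: (@continuous_to_initial T {ptws I -> V} V (fun h => h i)) => s.
exact: gc.
Qed.

Lemma ptws_eval_continuous (I : Type) (V : topologicalType) (i : I) :
  continuous (fun h : {ptws I -> V} => h i).
Proof.
move=> h A hA; have /cvg_sup/(_ i) : nbhs h --> h by exact: cvg_id.
apply; exact: (@initial_continuous {ptws I -> V} V (fun h => h i)) hA.
Qed.

Lemma hausdorff_separating (R : realType) (T : topologicalType) :
  (forall s t : T, s <> t -> exists2 f : T -> R, continuous f & f s <> f t) ->
  hausdorff_space T.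
Proof.
move=> sep s t st; apply: contrapT => /sep[f fc]; apply.
apply: (@Rhausdorff R) => A B fA fB.
have [x [Ax Bx]] := st _ _ (fc s A fA) (fc t B fB).
by exists (f x).
Qed.

Lemma compact_homeo_image (T U : topologicalType) (f : T -> U) :
  compact [set: T] -> hausdorff_space U -> continuous f -> injective f ->
  homeomorphic T (range f).
Proof.
move=> cT hU fc fi.
have fP t : f t \in range f by rewrite inE; exists t.
pose F t : range f := exist _ (f t) (fP t).
have ex (u : range f) : exists t, f t = set_val u.
  by case: u => u uP; have /set_mem [t _ tu] := uP; exists t.
pose G u := projT1 (cid (ex u)).
have GK u : f (G u) = set_val u by rewrite /G; case: cid.
exists F, G; split.
- by apply: continuous_to_initial; exact: fc.
- apply/continuous_closedP => C cC.
  have cfC : closed (f @` C).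
    apply: (compact_closed hU); apply: continuous_compact.
      exact: continuous_subspaceT.
    exact: subclosed_compact cC cT _.
  have -> : G @^-1` C = (set_val : range f -> U) @^-1` (f @` C).
    apply/seteqP; split => u /=; first by move=> Cu; exists (G u).
    by move=> [t Ct]; rewrite -GK => /fi <-.
  have /continuous_closedP : continuous (set_val : range f -> U).
    exact: initial_continuous.
  exact.
- by move=> t; apply: fi; rewrite GK.
- by move=> u; apply: val_inj => /=; rewrite GK.
Qed.

End topology_lemmas.

(** * Point-bounded separating families and uniform Eberlein compacta *)
Section weak.
Local Open Scope ring_scope.
Context {R : realType} {I : choiceType}.
Local Notation H := (@ell2 R I).

Lemma weak_continuous (f : dual H) :
  continuous (fun u : weak_space H => sval f u : R).
Proof.
move=> u.
apply: (@continuous_comp (weak_space H) {ptws dual H -> R} R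
   (fun x => fun f : dual H => sval f x) (fun h => h f)).
  exact: initial_continuous.
exact: ptws_eval_continuous.
Qed.

Lemma dot2_scalar (v : H) : linear_for ( *%R ) (dot2 v).
Proof. by move=> a u w; rewrite dot2Pr. Qed.

HB.instance Definition _ (v : H) :=
  GRing.isLinear.Build R H R ( *%R ) (dot2 v) (dot2_scalar v).

Lemma dot2_ebasis_continuous (i : I) :
  continuous (dot2 (ebasis i) : H -> R).
Proof.
move=> u; apply/(@cvgrPdist_lt _ _ _ (nbhs u)) => e e0.
apply: (@filterS _ (nbhs u) _ (ball u e) _ _ (nbhsx_ballx u e e0)) => v.
rewrite -ball_normE /= => uv.
by rewrite !dot2_ebasis -ell2_subE (le_lt_trans (ell2_coord_le _ _)).
Qed.

(** The coordinate [i], as an element of the dual space. *)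
Definition coord_functional (i : I) : dual H :=
  exist _ (dot2 (ebasis i) : {scalar H}) (@dot2_ebasis_continuous i).

Lemma weak_hausdorff : hausdorff_space (weak_space H).
Proof.
apply: (@hausdorff_separating R) => u v uv.
have [i uvi] : exists i, (u : H) i <> (v : H) i.
  apply: contrapT => /forallNP uvE; apply: uv.
  by apply: val_inj; apply/funext => i; exact: contrapT (uvE i).
exists (fun w : weak_space H => sval (coord_functional i) w).
  exact: weak_continuous.
by rewrite /= !dot2_ebasis.
Qed.

End weak.

(** A compact Hausdorff space with a separating family of clopen sets, no
    point of which lies in more than [n] members, embeds in a Hilbert space
    with its weak topology: send [t] to the sum of the basis vectors
    [ebasis i] over the [i] with [t] in [E i]. *)
Section eberlein.
Local Open Scope ring_scope.
Context {R : realType} {I : choiceType} {T : topologicalType}.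
Local Notation H := (@ell2 R I).
Variables (E : I -> set T) (n : nat).
Hypothesis clopenE : forall i, clopen (E i).
Hypothesis bounded : forall t (A : {fset I}),
  (forall i, i \in A -> E i t) -> (#|` A| <= n)%N.
Hypothesis separating : forall s t, (forall i, E i s <-> E i t) -> s = t.

Let D t : {fset I} := fset_set [set i | E i t].

Let finD t : finite_set [set i | E i t].
Proof.
apply: contrapT => inf; have [A sA] := infinite_set_fset n.+1 inf.
by rewrite ltnNge (bounded (t := t))// => i /sA.
Qed.

Let inD t i : (i \in D t) = `[< E i t >].
Proof. by rewrite in_fset_set//; apply/idP/idP; rewrite inE => /asboolP. Qed.

Let cardD t : (#|` D t| <= n)%N.
Proof. by apply: (@bounded t) => i; rewrite inD => /asboolP. Qed.

Let phi t : H := \sum_(i <- D t) 1 *: ebasis i.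

Let phiE t i : phi t i = (i \in D t)%:R.
Proof. by rewrite /phi sum_ebasisE; case: ifP. Qed.

Let phi_inj : injective phi.
Proof.
move=> s t st; apply: separating => i.
have : phi s i = phi t i by rewrite st.
rewrite !phiE !inD => /eqP; rewrite eqr_nat.
by move=> /eqP Est; split => ?; apply/asboolP; move: Est;
  case: asboolP => //; case: asboolP.
Qed.

Let sum_small (g : I -> R) (e : R) t (B : {fset I}) : 0 <= e ->
  (forall i, i \notin B -> `|g i| <= e) ->
  `|\sum_(i <- D t | i \notin B) g i| <= n%:R * e.
Proof.
move=> e0 ge; apply: le_trans (ler_norm_sum _ _ _) _.
apply: (@le_trans _ _ (\sum_(i <- D t) e)).
  rewrite big_mkcond /=; apply: ler_sum => i _.
  by case: ifP => // /ge.
rewrite big_const_seq count_predT iter_addr_0 -[leLHS]mulr_natl ler_wpM2r//.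
by rewrite ler_nat cardD.
Qed.

(* A continuous functional is at least [d] in absolute value on finitely many
   basis vectors only, those of [B]. Points that belong to the same members
   [E i], [i] in [B], as [t] form a neighbourhood of [t]; on it, the at most [n]
   other terms in each of the two sums add up to at most [n * d]. *)
Let phi_continuous : continuous (phi : T -> weak_space H).
Proof.
apply: continuous_to_initial; apply: continuous_to_ptws => f t /=.
apply/cvgrPdist_lt => e e0.
pose g i := sval f (ebasis i).
have fphi s : sval f (phi s) = \sum_(i <- D s) g i.
  rewrite /phi linear_sum; apply: eq_bigr => i _.
  by rewrite linearZ /= mul1r.
pose d := e / (2 * n%:R + 1).
have n0 : 0 <= n%:R :> R by [].
have d0 : 0 < d by rewrite divr_gt0//; lra.
have fB := finite_big_functional (svalP f) d0.
pose B := fset_set [set i | d <= `|sval f (ebasis i)|].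
have gB i : i \notin B -> `|g i| <= d.
  rewrite /B in_fset_set// => iB; rewrite leNgt; apply: contra iB => /ltW h.
  by rewrite inE.
have : \forall s \near t, forall i, i \in B -> (i \in D s) = (i \in D t).
  change (nbhs t (\bigcap_(i in [set` B]) [set s | (i \in D s) = (i \in D t)])).
  apply: filter_bigI => i iB.
  have [oE cE] := clopenE i.
  have [Eit|Eit] := pselect (E i t).
    apply: filterS (open_nbhs_nbhs (conj oE Eit)) => s /= Eis.
    by rewrite !inD !asboolT.
  have oC : open (~` E i) by rewrite openC.
  apply: filterS (open_nbhs_nbhs (conj oC Eit)) => s /= Eis.
  by rewrite !inD !asboolF.
apply: filterS => s sB; rewrite !fphi.
rewrite (bigID (mem B)) [X in `|_ - X|](bigID (mem B)) /=.
have -> : \sum_(i <- D s | i \in B) g i = \sum_(i <- D t | i \in B) g i.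
  apply: eq_fbig_cond => // i; rewrite !inE.
  by case: (boolP (i \in B)) => [/sB ->|]; rewrite ?andbF.
rewrite opprD addrACA subrr add0r (le_lt_trans (ler_normB _ _))//.
have hs := sum_small s (ltW d0) gB; have ht := sum_small t (ltW d0) gB.
apply: (@le_lt_trans _ _ (2 * n%:R * d)); first lra.
by rewrite /d mulrA ltr_pdivrMr; nra.
Qed.

Lemma eberlein_criterion : compact [set: T] -> hausdorff_space T ->
  uniform_eberlein_compact R T.
Proof.
move=> cT hT; split; first by [].
exists H, (range (phi : T -> weak_space H)); split.
- exact: ell2_hilbert.
- apply: continuous_compact => //.
  by apply: continuous_subspaceT => t; exact: phi_continuous.
- apply: (compact_homeo_image cT weak_hausdorff) phi_inj.
  exact: phi_continuous.
Qed.

End eberlein.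

(** * Cardinality and well-orders *)
Section cardinals.
Local Open Scope card_scope.

Lemma card_le_inj (T U : Type) (A : set T) : inhabited U ->
  A #<= [set: U] -> exists f : T -> U, {in A &, injective f}.
Proof.
case=> u; elim/Ppointed: U u => U; first by move=> u; case: (no u).
by move=> _ /pcard_injP.
Qed.

Lemma inj_card_leT (T U : Type) (A : set T) (f : T -> U) :
  {in A &, injective f} -> A #<= [set: U].
Proof.
by move=> /inj_card_eq fA; rewrite -(card_le_eql fA) card_leT.
Qed.

Lemma card_le_range (T U : Type) (A : set T) : A !=set0 ->
  A #<= [set: U] -> exists g : U -> T, range g = A.
Proof.
move=> [a Aa] /pfcard_geP[A0|[g]]; first by move: Aa; rewrite A0.
exists g; apply/seteqP; split; last exact: surj.
by move=> _ [u _ <-]; exact: funS.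
Qed.

(** A well-founded trichotomous relation with countable initial segments
    injects into any uncountable type: by recursion, each element is sent to a
    value not taken on its predecessors. *)
Lemma wf_card_le (P U : Type) (lt : P -> P -> Prop) : well_founded lt ->
  (forall p q, [\/ p = q, lt p q | lt q p]) ->
  (forall q, countable [set p | lt p q]) -> ~ countable [set: U] ->
  [set: P] #<= [set: U].
Proof.
move=> wf tri cnt unc.
have [u0 _] : [set: U] !=set0.
  by apply/set0P; apply/eqP => U0; apply: unc; rewrite U0.
have fresh q (h : forall p, lt p q -> U) :
    exists u, forall p (pq : lt p q), h p pq <> u.
  pose h' p := if pselect (lt p q) is left pq then h p pq else u0.
  have ch : countable (h' @` [set p | lt p q]).
    exact: sub_countable (card_image_le _ _) (cnt q).
  have [u uh] : exists u, ~ (h' @` [set p | lt p q]) u.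
    apply: contrapT => /forallNP uh; apply: unc; apply: sub_countable ch.
    by apply: subset_card_le => u _; exact: contrapT (uh u).
  exists u => p pq hu; apply: uh; exists p => //=; rewrite /h'.
  by case: pselect => // pq'; rewrite (Prop_irrelevance pq' pq).
pose h := Fix wf (fun=> U) (fun q h => projT1 (cid (fresh q h))).
have hE q : h q = projT1 (cid (fresh q (fun p _ => h p))).
  rewrite /h Fix_eq// => {}q f g fg; congr (projT1 (cid (fresh q _))).
  by apply: functional_extensionality_dep => p; apply/funext => pq.
have hlt p q : lt p q -> h p <> h q.
  by move=> pq; rewrite (hE q); case: cid => u /= /(_ p pq).
apply: (@inj_card_leT _ _ _ h) => p q _ _ hpq.
by case: (tri p q) => // /hlt; rewrite hpq.
Qed.

End cardinals.

Section well_orders.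
Context d (T : orderType d).
Hypothesis wo : wochoice.well_order (fun x y : T => (x <= y)%O).
Local Open Scope order_scope.

Lemma wo_least (A : set T) : A !=set0 ->
  exists2 x, A x & forall y, A y -> x <= y.
Proof.
move=> [a Aa]; have [|x [[xA xmin] _]] := wo (A := mem A).
  by exists a; rewrite inE.
exists x; first by move: xA; rewrite inE.
by move=> y Ay; apply: xmin; rewrite inE.
Qed.

Lemma wo_wf : well_founded (fun x y : T => x < y).
Proof.
move=> x; apply: contrapT => nx.
have [//|y /= ny ymin] := wo_least (A := [set x | ~ Acc (fun x y => x < y) x]).
  by exists x.
apply: ny; constructor => z zy; apply: contrapT => /ymin.
by rewrite leNgt zy.
Qed.

Lemma wo_ind (P : T -> Prop) :
  (forall x, (forall y, y < x -> P y) -> P x) -> forall x, P x.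
Proof. by move=> ih x; elim/(well_founded_ind wo_wf): x. Qed.

End well_orders.

(** The left-hand side is the form that initial segments take in
    [is_successor_cardinal] and [has_cofinality]: the set of members of a
    set. *)
Lemma initial_segmentE d (T : orderType d) (b : T) :
  [set` `]-oo, b[%classic] = [set x | (x < b)%O].
Proof. by apply/seteqP; split => x /=; rewrite inE /= ?in_itv. Qed.

(** * Cardinal arithmetic of the first uncountable cardinals *)
Section omega1.
Local Open Scope card_scope.
Context d (T : orderType d).
Hypothesis T1 : is_omega1 T.

Lemma omega1_inhabited : inhabited T.
Proof.
case: T1 => _ unc _; apply: contrapT => Te; apply: unc.
rewrite (_ : [set: T] = set0)//; apply/seteqP; split=> // t _.
by case: Te; constructor.
Qed.

Lemma omega1_lec_countable (b : T) : countable [set x | (x <= b)%O].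
Proof.
case: T1 => _ _ /(_ b); rewrite initial_segmentE => cb.
apply: (@sub_countable _ _ _ ([set x | (x < b)%O] `|` [set b])).
  apply: subset_card_le => x /=; rewrite le_eqVlt => /predU1P[->|xb].
    by right.
  by left.
have -> : [set x | (x < b)%O] `|` [set b] =
   \bigcup_(i in [set: bool]) (if i then [set x | (x < b)%O] else [set b]).
  apply/seteqP; split => x; first by case; [exists true|exists false].
  by case=> -[] _; [left|right].
apply: bigcup_countable => [|[] _]; [exact: countableP|exact: cb|].
by apply: finite_set_countable; exact: finite_set1.
Qed.

Lemma omega1_prod_nat : [set: T * nat] #<= [set: T].
Proof.
case: (T1) => wo unc _.
pose lt (p q : T * nat) := (p.1 < q.1)%O \/ (p.1 = q.1 /\ (p.2 < q.2)%N).
apply: (@wf_card_le _ _ lt _ _ _ unc).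
- move=> [a n]; elim/(wo_ind wo): a n => a iha.
  elim/ltn_ind => n ihn; constructor => -[b m]; rewrite /lt /= => -[ba|[-> mn]].
    exact: iha.
  exact: ihn.
- move=> [a n] [b m]; rewrite /lt /=.
  have [ab|ba|->] := ltgtP a b.
  - by constructor 2; left.
  - by constructor 3; left.
  have [nm|mn|->] := ltgtP n m; last by constructor 1.
    by constructor 2; right.
  by constructor 3; right.
- move=> [b m].
  apply: (@sub_countable _ _ _ ([set x | (x <= b)%O] `*` [set: nat])).
    apply: subset_card_le => -[a n]; rewrite /lt /= => ab; split => //=.
    by case: ab => [/ltW//|[-> _]].
  by apply: countableX => //; exact: omega1_lec_countable.
Qed.

(** A pair is coded by its larger component [b] and by twice the rank of the
    other one in an enumeration of the countable set of the elements up to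
    [b], plus one if the larger component comes first. *)
Lemma omega1_prod : [set: T * T] #<= [set: T].
Proof.
apply: card_le_trans omega1_prod_nat.
have /choice [e eP] : forall b : T, exists e : T -> nat,
    {in [set x | (x <= b)%O] &, injective e}.
  by move=> b; apply/countable_injP; exact: omega1_lec_countable.
apply: (@inj_card_leT _ _ _ (fun p : T * T =>
  if (p.1 <= p.2)%O then (p.2, (e p.2 p.1).*2) else (p.1, (e p.1 p.2).*2.+1))).
move=> [a b] [a' b'] _ _ /=.
have oddE n m : n.*2 = m.*2.+1 -> False.
  by move=> /(congr1 odd); rewrite /= !odd_double.
have [ab|ba] := leP a b; have [ab'|ba'] := leP a' b'.
- move=> [bb']; rewrite -{}bb' in ab' * => /double_inj.
  by move=> /(eP b)-> //; rewrite inE.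
- by move=> [_ /oddE].
- by move=> [_ /esym/oddE].
- move=> [aa']; rewrite -{}aa' in ba' * => /double_inj.
  by move=> /(eP a)-> //; rewrite inE /= ltW.
Qed.

End omega1.

Section omega2.
Local Open Scope card_scope.
Context d1 (T1 : orderType d1) d2 (T2 : orderType d2).
Hypothesis T2P : is_omega2 T1 T2.

(** If the values of [g] were unbounded, each [b] in the second uncountable
    cardinal would be coded by some [x] in [A] with [b <= g x] and by its
    position below [g x]; this gives an injection into the square of the first
    uncountable cardinal. *)
Lemma omega2_regular (T : Type) (A : set T) (g : T -> T2) :
  A #<= [set: T1] -> exists b, forall x, A x -> (g x < b)%O.
Proof.
have [T1P [wo2 big small]] := T2P; have T1i := omega1_inhabited T1P.
move=> AT1; apply: contrapT => /forallNP unb.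
have /choice [x xP] : forall b, exists x, A x /\ (b <= g x)%O.
  move=> b; apply: contrapT => /forallNP nx; apply: (unb b) => x Ax.
  by rewrite ltNge; apply/negP => bx; apply: (nx x).
have [i iP] := card_le_inj T1i AT1.
have /choice [e eP] : forall y : T2, exists e : T2 -> T1,
    {in [set x | (x < y)%O] &, injective e}.
  by move=> y; apply: card_le_inj => //; rewrite -initial_segmentE.
apply: big; apply: card_le_trans (omega1_prod T1P).
have [f fi] : exists f : T1 * nat -> T1, injective f.
  have [f fi] := card_le_inj T1i (omega1_prod_nat T1P).
  by exists f => p q /fi; apply; rewrite inE.
(* The natural number singles out [b = g (x b)], which does not lie strictly
   below [g (x b)] and thus is not handled by the injection [e]. *)
apply: (@inj_card_leT _ _ _ (fun b => (i (x b),
  f (e (g (x b)) b, nat_of_bool (b == g (x b)))))).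
move=> b c _ _ [ixy /fi[]].
have xbc : x b = x c by apply: iP => //; rewrite inE; apply: (xP _).1.
rewrite -xbc => ebc; case: (eqVneq b (g (x b))) => [bE|bn];
  case: (eqVneq c (g (x b))) => [cE|cn] // _.
  exact: etrans bE (esym cE).
apply: eP ebc; rewrite inE /= lt_neqAle; first by rewrite bn (xP b).2.
by rewrite cn xbc (xP c).2.
Qed.

Lemma omega2_regular_nat (T : Type) (A : set T) (g : T -> T2) :
  countable A -> exists b, forall x, A x -> (g x < b)%O.
Proof.
move=> cA; apply: omega2_regular; apply: card_le_trans cA _.
have T1P := T2P.1; have [a] := omega1_inhabited T1P.
case/card_le_inj: (omega1_prod_nat T1P); first by constructor.
move=> f fi; apply: (@inj_card_leT _ _ _ (fun n => f (a, n))) => m n _ _ fmn.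
by have [] : (a, m) = (a, n) by apply: fi; rewrite ?inE.
Qed.

(** The first case covers successors as well as countable cofinality, since
    the cofinal map is not required to be increasing. *)
Lemma omega2_cofinality (b a0 : T2) : (a0 < b)%O ->
  (exists f : nat -> T2, cofinal_map setT b f) \/ has_cofinality b T1.
Proof.
have [T1P [wo2 big small]] := T2P => a0b.
have [fcof|nf] := pselect (exists f : nat -> T2, cofinal_map setT b f).
  by left.
right; split.
  have [|g gb] := card_le_range _ (small b).
    by exists a0; rewrite initial_segmentE.
  exists g; split=> [l _|x xb].
    have : range g (g l) by exists l.
    by rewrite gb initial_segmentE.
  have : range g x by rewrite gb initial_segmentE.
  by move=> [l _ <-]; exists l.
move=> l f [fb fcof]; apply: nf.
have [l0 l0P _] := fcof _ a0b.
have [|h hl] := card_le_range _ (let: And3 _ _ c := T1P in c l).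
  by exists l0.
have hP n : [set` `]-oo, l[%classic] (h n) by rewrite -hl; exists n.
exists (f \o h); split=> [n _|x /fcof[m]]; first exact: fb.
by rewrite -hl => -[n _ <-] xn; exists n.
Qed.

End omega2.

(** * Disjointification of a non-reflecting ladder system *)
(** In an order topology, a neighbourhood of a point that is not minimal
    contains a half-open interval ending at this point. *)
Lemma order_nbhs_left d (T : orderType d) (a : order_topology T)
    (U : set (order_topology T)) :
  nbhs a U -> (exists l, (l < a)%O) ->
  exists2 l, (l < a)%O & forall x, (l < x)%O -> (x <= a)%O -> U x.
Proof.
rewrite order_nbhs_itv => -[[l r] [/= oi ai] iU] [l0 l0a].
have right x : (x <= a)%O -> (BRight x <= r)%O.
  move=> xa; move: ai; rewrite itv_boundlr => /andP[_].
  by apply: le_trans; rewrite bnd_simp.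
move: ai; rewrite itv_boundlr => /andP[la _].
case: l oi la iU => [[] l|[]] oi la iU //.
- exists l; first by move: la; rewrite bnd_simp.
  by move=> x lx /right xr; apply: iU; rewrite /= itv_boundlr bnd_simp lx.
- exists l0 => // x _ /right xr; apply: iU; rewrite /= itv_boundlr.
  by rewrite xr.
Qed.

Section ladder.
Local Open Scope ring_scope.
Context d1 (T1 : orderType d1) d2 (T2 : orderType d2).
Hypothesis T2P : is_omega2 T1 T2.
Variable (S : set T2).
Hypothesis S_nonreflecting : forall b : T2, has_cofinality b T1 ->
  ~ stationary [set x : predecessors b | S (val x)].
Variable (p : T2 -> nat -> T2).
Hypothesis p_incr : forall a : T2, S a ->
  forall m n : nat, (m < n)%N -> (p a m < p a n)%O.
Hypothesis p_cvg : forall a : T2, S a ->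
  (p a : nat -> order_topology T2) @ \oo --> (a : order_topology T2).

Let wo2 : wochoice.well_order (fun x y : T2 => (x <= y)%O) :=
  let: And3 w _ _ := T2P.2 in w.

Local Notation A a := (range (p a)).

Lemma ladder_lt a n : S a -> (p a n < a)%O.
Proof.
move=> Sa; rewrite ltNge; apply/negP => ap.
have aS : (a < p a n.+1)%O by apply: le_lt_trans ap _; exact: p_incr.
have : nbhs (a : order_topology T2) [set` `]-oo, p a n.+1[].
  apply: open_nbhs_nbhs; split; last by rewrite /= in_itv.
  exact: (@lray_open _ (order_topology T2)).
move=> /(p_cvg Sa)[N _ /(_ (maxn N n.+1))].
rewrite /= in_itv /= leq_maxl => /(_ isT).
have := leq_maxr N n.+1; rewrite leq_eqVlt => /predU1P[<-|/(p_incr Sa)].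
  by rewrite ltxx.
by move=> /lt_trans h /h; rewrite ltxx.
Qed.

Lemma ladder_finite_le a x : S a -> (x < a)%O ->
  finite_set [set y | A a y /\ (y <= x)%O].
Proof.
move=> Sa xa.
have : nbhs (a : order_topology T2) [set` `]x, +oo[].
  apply: open_nbhs_nbhs; split; last by rewrite /= in_itv /= andbT.
  exact: (@rray_open _ (order_topology T2)).
move=> /(p_cvg Sa)[N _ Np].
apply: (@sub_finite_set _ _ (p a @` `I_N)); last first.
  by apply: finite_image; exact: finite_II.
move=> _ [[n _ <-] nx]; exists n => //=; rewrite ltnNge; apply/negP => Nn.
by have := Np n Nn; rewrite /= in_itv /= andbT ltNge nx.
Qed.

Lemma ladder_inj a : S a -> injective (p a).
Proof.
move=> Sa m n mn; apply/eqP; case: ltngtP => // /(p_incr Sa);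
  by rewrite mn ltxx.
Qed.

Lemma ladder_infinite a : S a -> infinite_set (A a).
Proof.
move=> Sa; apply/infiniteP.
have /card_eqPle[_] // : (A a #= [set: nat])%card.
by apply: inj_card_eq => m n _ _; exact: ladder_inj.
Qed.

Lemma ladder_almost_disjoint a b : S a -> S b -> a <> b ->
  finite_set (A a `&` A b).
Proof.
wlog ab : a b / (a < b)%O.
  move=> h Sa Sb ab; have [lab|lba|//] := ltgtP a b; first exact: h.
  by rewrite setIC; apply: h => // /esym.
move=> Sa Sb _; apply: sub_finite_set (ladder_finite_le Sb ab) => y.
by move=> [[n _ <-] Aby]; split => //; exact/ltW/ladder_lt.
Qed.

(** Removing the finite sets [F a] makes the ladders indexed by the elements
    of [S] that satisfy [Q] pairwise disjoint. *)
Definition disjointifies (Q : set T2) (F : T2 -> set T2) :=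
  (forall a, S a -> Q a -> finite_set (F a)) /\
  (forall a b, S a -> S b -> Q a -> Q b -> a <> b ->
     (A a `\` F a) `&` (A b `\` F b) = set0).

(** The ladders below [b] are sorted by the invariant [k]. Those with the same
    invariant lie below a common [c a < b], where they are disjointified by
    hypothesis; those with different invariants are separated by removing the
    sets [G a]. *)
Lemma disjointify_glue (b : T2) (K : eqType) (k : T2 -> K) (c : T2 -> T2)
    (G : T2 -> set T2) :
  (forall g, (g < b)%O -> exists F, disjointifies [set a | (a <= g)%O] F) ->
  (forall a, S a -> (a < b)%O -> (a <= c a < b)%O /\ finite_set (G a)) ->
  (forall a a', S a -> S a' -> (a < b)%O -> (a' < b)%O -> k a = k a' ->
     c a = c a') ->
  (forall a a', S a -> S a' -> (a < b)%O -> (a' < b)%O -> k a <> k a' ->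
     (forall y, A a' y -> ~ G a' y -> (a <= y)%O) \/
     (forall y, A a y -> ~ G a y -> (a' <= y)%O)) ->
  exists F, disjointifies [set a | (a < b)%O] F.
Proof.
move=> ih cG ck kG.
have /choice [F FP] : forall g, exists F : T2 -> set T2,
    (g < b)%O -> disjointifies [set a | (a <= g)%O] F.
  move=> g; have [gb|gb] := ltP g b; last by exists (fun=> set0).
  by have [F FP] := ih g gb; exists F.
exists (fun a => F (c a) a `|` G a); split=> [a Sa ab|a a' Sa Sa' ab a'b aa'].
  have [/andP[ac cb] fG] := cG a Sa ab.
  by rewrite finite_setU; split => //; exact: (FP (c a) cb).1.
apply/seteqP; split=> // y [[Aay /not_orP[nF nG]] [Aa'y /not_orP[nF' nG']]].
have ya : (y < a)%O by move: Aay => [n _ <-]; exact: ladder_lt.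
have ya' : (y < a')%O by move: Aa'y => [n _ <-]; exact: ladder_lt.
have [kk|/eqP kk] := eqVneq (k a) (k a').
  have cc := ck _ _ Sa Sa' ab a'b kk.
  have [/andP[ac cb] _] := cG a Sa ab; have [/andP[a'c _] _] := cG a' Sa' a'b.
  rewrite -cc in a'c nF'.
  have := (FP _ cb).2 a a' Sa Sa' ac a'c aa'.
  by move=> /seteqP[/(_ y) h _]; apply: h.
have [h|h] := kG _ _ Sa Sa' ab a'b kk.
  by have := h y Aa'y nG'; rewrite leNgt ya.
by have := h y Aay nG; rewrite leNgt ya'.
Qed.

(** Along a countable cofinal sequence, [k a] is the first index at which the
    sequence reaches [a], and the part of the ladder of [a] below a value of
    the sequence at a smaller index is removed. *)
Lemma disjointify_countable (b : T2) (f : nat -> T2) :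
  cofinal_map setT b f ->
  (forall g, (g < b)%O -> exists F, disjointifies [set a | (a <= g)%O] F) ->
  exists F, disjointifies [set a | (a < b)%O] F.
Proof.
move=> [fb fcof] ih.
have /choice [k kP] : forall a, exists n : nat, (a < b)%O ->
    (a <= f n)%O /\ forall m, (m < n)%N -> (f m < a)%O.
  move=> a; have [ab|ab] := ltP a b; last by exists 0%N.
  have ex : exists n, (a <= f n)%O.
    by have [n _ an] := fcof a ab; exists n.
  case: (ex_minnP ex) => n an nmin; exists n => _; split => // m mn.
  by rewrite ltNge; apply: contraL mn => /nmin; rewrite -leqNgt.
pose G a : set T2 := [set y | A a y /\ exists2 m, (m < k a)%N & (y <= f m)%O].
apply: (@disjointify_glue b _ k (f \o k) G) => //.
- move=> a Sa ab; have [ak kmin] := kP a ab.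
  split; first by rewrite /= ak fb.
  apply: (@sub_finite_set _ _ (\bigcup_(m in `I_(k a))
      [set y | A a y /\ (y <= f m)%O])).
    by move=> y [Ay [m mk ym]]; exists m.
  apply: bigcup_finite; first exact: finite_II.
  by move=> m /= /kmin; exact: ladder_finite_le.
- by move=> a a' _ _ _ _ /= ->.
have sep a a' : S a -> S a' -> (a < b)%O -> (a' < b)%O -> (k a < k a')%N ->
    forall y, A a' y -> ~ G a' y -> (a <= y)%O.
  move=> Sa Sa' ab a'b kk y Ay nG; rewrite leNgt; apply/negP => ya; apply: nG.
  by split=> //; exists (k a) => //; exact: le_trans (ltW ya) (kP a ab).1.
move=> a a' Sa Sa' ab a'b /eqP; case: ltngtP => // kk _; [left|right];
  by apply: sep.
Qed.

(** Along a club [C] that misses [S], [c a] is the first element of [C] above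
    [a]. Removing from the ladder of [a] the part that lies below an element
    of [C] smaller than [a] removes a finite set only: [a] is not in the
    closed set [C], so the elements of [C] smaller than [a] are bounded below
    [a]. *)
Lemma disjointify_club (b : T2) (C : set (predecessors b)) :
  closed (C : set (order_topology (predecessors b))) -> unbounded C ->
  (forall x, C x -> ~ S (val x)) ->
  (forall g, (g < b)%O -> exists F, disjointifies [set a | (a <= g)%O] F) ->
  exists F, disjointifies [set a | (a < b)%O] F.
Proof.
move=> clC ubC CS ih.
have /choice [c cP] : forall a : T2, exists c : T2, (a < b)%O ->
    [/\ (a <= c)%O, (c < b)%O, (exists2 x, C x & val x = c) &
        forall x, C x -> (a <= val x)%O -> (c <= val x)%O].
  move=> a; have [ab|ab] := ltP a b; last by exists a.
  have [|_ [x [Cx ax <-]] xmin] := wo_least wo2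
      (A := [set c | exists x, [/\ C x, (a <= val x)%O & val x = c]]).
    have [x Cx xa] := ubC (exist _ a ab).
    by exists (val x), x; split => //; exact: ltW.
  exists (val x) => _; split => //; [exact: (valP x)|by exists x|].
  by move=> y Cy ay; apply: xmin; exists y.
pose G a : set T2 :=
  [set y | A a y /\ exists x, [/\ C x, (val x < a)%O & (y <= val x)%O]].
apply: (@disjointify_glue b _ c c G) => //.
- move=> a Sa ab; have [ac cb _ _] := cP a ab.
  split; first by rewrite ac cb.
  pose a' : predecessors b := exist _ a ab.
  have na : (~` (C : set (order_topology (predecessors b)))) a'.
    by move=> Ca; exact: CS Ca Sa.
  have pb : (p a 0 < b)%O by apply: lt_trans (ab); exact: ladder_lt.
  have [||l la lC] := @order_nbhs_left _ (predecessors b) a' (~` C).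
  + by apply: open_nbhs_nbhs; split=> //; rewrite openC.
  + by exists (exist _ (p a 0) pb : predecessors b); exact: ladder_lt.
  apply: sub_finite_set (ladder_finite_le Sa (x := val l) la) => y.
  move=> [Ay [x [Cx xa yx]]]; split => //; apply: le_trans yx _.
  rewrite leNgt; apply/negP => lx; apply: (lC x) Cx => //.
  exact: ltW.
have sep a a' : S a -> S a' -> (a < b)%O -> (a' < b)%O -> (c a < c a')%O ->
    forall y, A a' y -> ~ G a' y -> (a <= y)%O.
  move=> Sa Sa' ab a'b cc y Ay nG; rewrite leNgt; apply/negP => ya; apply: nG.
  have [ac _ [x Cx xc] _] := cP a ab; have [_ _ _ cmin] := cP a' a'b.
  split=> //; exists x; split=> //; rewrite xc; last first.
    exact: le_trans (ltW ya) ac.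
  by rewrite ltNge -xc; apply/negP => /(cmin _ Cx); rewrite xc leNgt cc.
move=> a a' Sa Sa' ab a'b /eqP; case: ltgtP => // cc _; [left|right];
  by apply: sep.
Qed.

(** The induction step; non-reflection provides the club when [b] has
    uncountable cofinality. *)
Lemma disjointify_lt (b : T2) :
  (forall g, (g < b)%O -> exists F, disjointifies [set a | (a <= g)%O] F) ->
  exists F, disjointifies [set a | (a < b)%O] F.
Proof.
move=> ih; have [[a0 a0b]|b0] := pselect (exists a, (a < b)%O); last first.
  by exists (fun=> set0); split=> [a _ ab|a a' _ _ ab]; case: b0; exists a.
have [[f fP]|cb] := omega2_cofinality T2P a0b.
  exact: disjointify_countable fP ih.
have := S_nonreflecting cb; rewrite /stationary => /existsNP[C].
move=> /not_implyP[clC /not_implyP[ubC nSC]].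
apply: disjointify_club clC ubC _ ih => x Cx Sx; apply: nSC.
by exists x.
Qed.

Lemma disjointify_le (b : T2) :
  exists F, disjointifies [set a | (a <= b)%O] F.
Proof.
elim/(wo_ind wo2): b => b /disjointify_lt[F [Ffin Fdisj]].
(* From each lower ladder, also remove its intersection with the ladder of [b];
   the ladder of [b] itself is kept whole. *)
exists (fun a => if (a < b)%O
  then F a `|` [set y | A b y /\ (y <= a)%O] `&` [set _ | S b] else set0).
split=> [a Sa /= ab|].
  case: ifP => // {}ab; rewrite finite_setU; split; first exact: Ffin.
  have [Sb|nSb] := pselect (S b).
    by apply: finite_setIl; exact: ladder_finite_le.
  by rewrite (_ : _ `&` _ = set0)//; apply/seteqP; split => // y [].
have sep a y : S a -> S b -> (a < b)%O -> A a y -> A b y ->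
    ~ (F a `|` [set y | A b y /\ (y <= a)%O] `&` [set _ | S b]) y -> False.
  move=> Sa Sb ab [n _ <-] Ab; apply; right; split=> //; split=> //.
  exact/ltW/ladder_lt.
move=> a a' Sa Sa' /=.
rewrite !le_eqVlt => /predU1P[ab|ab] /predU1P[a'b|a'b] aa'.
- by case: aa'; rewrite ab a'b.
- rewrite ab in Sa *; rewrite ltxx a'b.
  apply/seteqP; split=> // y [[Ay _] [A'y nF]].
  exact: (sep a' y Sa' Sa a'b A'y Ay nF).
- rewrite a'b in Sa' *; rewrite ltxx ab.
  apply/seteqP; split=> // y [[Ay nF] [A'y _]].
  exact: (sep a y Sa Sa' ab Ay A'y nF).
- rewrite ab a'b.
  apply/seteqP; split=> // y [[Ay /not_orP[nF _]] [A'y /not_orP[nF' _]]].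
  have := Fdisj a a' Sa Sa' ab a'b aa'.
  by move=> /seteqP[/(_ y) h _]; apply: h.
Qed.

End ladder.

(** * Stone spaces of fields of sets *)
Section field_of_sets_theory.
Context {T : Type} (X : set T) (E : set_system T).
Hypothesis EX : forall A, E A -> A `<=` X.
Local Notation G := (generated_field X E).

Lemma generated_base A : E A -> G A.
Proof. by move=> EA P [_]; apply. Qed.

Lemma generated_field_of_sets : field_of_sets X G.
Proof.
split.
- move=> A GA; apply: (GA (fun B => B `<=` X)); split; last exact: EX.
  by split=> [B|x|B BX x []|B C BX CX x [/BX]].
- by move=> P [[]].
- by move=> A GA P PE; apply: (field_compl PE.1); exact: GA.
- by move=> A B GA GB P PE; apply: (field_setI PE.1); [exact: GA|exact: GB].
Qed.

Lemma generated_ind (P : set_system T) :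
  (forall A, E A -> P A) -> P X ->
  (forall A, G A -> P A -> P (X `\` A)) ->
  (forall A B, G A -> G B -> P A -> P B -> P (A `&` B)) ->
  forall A, G A -> P A.
Proof.
move=> PE PX PC PI A GA; have GF := generated_field_of_sets.
apply: (GA (fun B => G B /\ P B) _).2; split.
  split.
  - by move=> B [/(field_sub GF)].
  - by split=> //; exact: field_top GF.
  - by move=> B [GB PB]; split; [exact: (field_compl GF)|exact: PC].
  - by move=> B C [GB PB] [GC PC']; split; [exact: (field_setI GF)|exact: PI].
by move=> B EB; split; [exact: generated_base|exact: PE].
Qed.

End field_of_sets_theory.

Section stone.
Context {T : Type} (X : set T) (G : set_system T).
Hypothesis GF : field_of_sets X G.
Local Notation K := (ult X G).
Implicit Types (u v : K) (A B : set T).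

(** The clopen set of the ultrafilters that contain [A]. *)
Definition basic A : set K := [set u | sval u A].

Lemma ult_eq u v : (forall A, G A -> sval u A <-> sval v A) -> u = v.
Proof.
move=> uv; suff : sval u = sval v.
  by case: u v {uv} => [u uP] [v vP] /= uv; exact: eq_exist.
apply/seteqP; split => A uA; apply/(uv A) => //; exact: (ult_sub (svalP _) uA).
Qed.

Lemma ult_disjoint u A B : sval u A -> sval u B -> A `&` B = set0 -> False.
Proof.
move=> uA uB AB; apply: (ult_proper (svalP u)); rewrite -AB.
exact: (ult_setI (svalP u)).
Qed.

Lemma ult_complN u A : G A -> ~ sval u A -> sval u (X `\` A).
Proof. by move=> GA nA; case: (ult_compl (svalP u) GA). Qed.

Lemma basicC A : G A -> basic (X `\` A) = ~` basic A.
Proof.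
move=> GA; apply/seteqP; split => u /= uA; last exact: ult_complN.
by move=> uA'; apply: (ult_disjoint uA uA'); rewrite setDKI.
Qed.

Lemma basic_open A : open (basic A).
Proof.
have [GA|nGA] := pselect (G A); last first.
  rewrite (_ : basic A = set0); first exact: open0.
  by apply/seteqP; split=> // u /(ult_sub (svalP u)).
exists [set basic A]; last by rewrite bigcup_set1.
move=> _ ->; exists (fset1 A); last by rewrite set_fset1 bigcap_set1.
by move=> B /fset1P ->; rewrite inE.
Qed.

Lemma basic_clopen A : clopen (basic A).
Proof.
split; first exact: basic_open.
have [GA|nGA] := pselect (G A); last first.
  rewrite (_ : basic A = set0); first exact: closed0.
  by apply/seteqP; split=> // u /(ult_sub (svalP u)).
by rewrite -openC -basicC//; exact: basic_open.
Qed.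

(** Stability under finite intersections turns the given subbase into a
    base. *)
Lemma ult_nbhsP u (V : set K) :
  nbhs u V <-> exists2 B, sval u B & basic B `<=` V.
Proof.
split=> [|[B uB BV]]; last first.
  apply: filterS BV _; apply: open_nbhs_nbhs; split => //; exact: basic_open.
case=> _ [[D DP] <-] [W] /[dup] /(DP _) [F FG <-] DW uF DV.
exists (\big[setI/X]_(A <- F) A).
  rewrite big_seq; apply: (big_ind (fun A => sval u A)).
  - exact: (ult_top (svalP u)).
  - exact: (ult_setI (svalP u)).
  - by move=> A AF; apply: uF.
move=> v vF; apply: DV.
exists (\bigcap_(i in [set` F]) [set u : K | sval u i]) => //.
move=> A AF; apply: (ult_up (svalP v) vF).
  by have /set_mem := FG A AF.
have : A \in (F : seq _) by [].
elim: (F : seq _) => // B s ih; rewrite inE big_cons => /predU1P[->|As] x [] //.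
by move=> _; exact: ih.
Qed.

Lemma ult_hausdorff : hausdorff_space K.
Proof.
move=> u v uv; apply: ult_eq.
have sub (w z : K) : cluster (nbhs w) z ->
    forall A, G A -> sval w A -> sval z A.
  move=> wz A GA wA; apply: contrapT => /(ult_complN GA) zA.
  have nA : nbhs w (basic A) by apply/ult_nbhsP; exists A.
  have nC : nbhs z (basic (X `\` A)) by apply/ult_nbhsP; exists (X `\` A).
  have [y [yA yA']] := wz _ _ nA nC.
  by move: yA'; rewrite basicC.
move=> A GA; split; apply: sub => //.
by move=> P Q Pv Qu; rewrite setIC; exact: uv.
Qed.

(** An ultrafilter [F] on the Stone space converges to the point [w] made of
    the sets [A] such that [basic A] belongs to [F]. *)
Lemma ult_compact : compact [set: K].
Proof.
rewrite compact_ultra => F FU _.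
have FP : ProperFilter F by exact: ultra_proper.
pose w : set_system T := [set A | G A /\ F (basic A)].
have wP : ultrafilter_of X G w.
  split.
  - by move=> A [].
  - split; first exact: field_top GF.
    apply: filterS filterT => u _; exact: (ult_top (svalP u)).
  - move=> [_ F0]; have [u u0] := filter_ex F0.
    exact: (ult_proper (svalP u)).
  - move=> A B [GA FA] [GB FB]; split; first exact: (field_setI GF).
    apply: filterS (filterI FA FB) => u [uA uB].
    exact: (ult_setI (svalP u)).
  - move=> A B [GA FA] GB AB; split=> //; apply: filterS FA => u uA.
    exact: (ult_up (svalP u)) uA GB AB.
  - move=> A GA; have [FA|FA] := in_ultra_setVsetC (basic A) FU.
      by left.
    by right; split; [exact: (field_compl GF)|rewrite basicC].
exists (exist _ w wP); split => // V /ult_nbhsP[B [GB FB] BV].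
exact: filterS FB.
Qed.

Lemma ult_principal_mem u x A : sval u [set x] -> sval u A -> A x.
Proof.
move=> ux uA; apply: contrapT => nAx; apply: (ult_disjoint ux uA).
by apply/seteqP; split=> // y [-> ].
Qed.

Lemma ult_principal u x A : G A -> sval u [set x] -> sval u A <-> A x.
Proof.
move=> GA ux; split; first exact: ult_principal_mem.
by move=> Ax; apply: (ult_up (svalP u) ux) => // _ ->.
Qed.

Lemma ult_nonprincipal_finite u A : (forall x, X x -> G [set x]) ->
  ~ (exists x, sval u [set x]) -> finite_set A -> ~ sval u A.
Proof.
move=> Gp nu fA uA; have AX := field_sub GF (ult_sub (svalP u) uA).
have /(_ _ fA AX) : forall B, finite_set B -> B `<=` X -> sval u (X `\` B).
  move=> B /finite_setP[n]; elim: n => [|n ih] in B *.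
    rewrite II0 card_eq0 => /eqP -> _; rewrite setD0.
    exact: (ult_top (svalP u)).
  move=> /eq_cardSP[x Bx /ih{}ih] BX.
  have -> : X `\` B = (X `\` (B `\ x)) `&` (X `\` [set x]).
    apply/seteqP; split => y /=.
      move=> [Xy nBy]; have nBx : ~ (B `\ x) y by move=> [].
      by have yx : y <> x by move=> yx; apply: nBy; rewrite yx.
    by move=> [[Xy nB] [_ yx]]; split=> // By; apply: nB.
  apply: (ult_setI (svalP u)); first by apply: ih => y [/BX].
  apply: ult_complN; first exact/Gp/BX.
  by move=> ux; apply: nu; exists x.
by move=> uA'; apply: (ult_disjoint uA uA'); rewrite setDIK.
Qed.

End stone.

(** * Compactness and separation of subspaces *)
Section subspaces.

Lemma hausdorff_injection (T U : topologicalType) (f : T -> U) :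
  continuous f -> injective f -> hausdorff_space U -> hausdorff_space T.
Proof.
move=> fc fi hU s t st; apply/fi/hU => A B fA fB.
have [x [Ax Bx]] := st _ _ (fc s A fA) (fc t B fB).
by exists (f x).
Qed.

Lemma compact_set_type (T : topologicalType) (A : set T) :
  compact A -> compact [set: A].
Proof.
move=> cA F FF _.
have FA : (set_val @ F) A.
  by apply: (@filterS _ F _ setT) filterT => a _; exact: set_valP.
have [t [At clt]] := cA (set_val @ F) _ FA.
exists (exist _ t (mem_set At)); split => // B V FB.
case=> _ [[W oW <-] Wt] WV.
have FB' : (set_val @ F) (set_val @` B).
  by apply: (@filterS _ F _ B) FB => b Bb; exists b.
have [_ [[b Bb <-] Wb]] := clt _ W FB' (open_nbhs_nbhs (conj oW Wt)).
by exists b; split => //; exact: WV.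
Qed.

End subspaces.

(** * Pressing down on a stationary set *)
Section pressing_down.
Local Open Scope ring_scope.
Context d1 (T1 : orderType d1) d2 (T2 : orderType d2).
Hypothesis T2P : is_omega2 T1 T2.
Variable (S : set T2).
Hypothesis S_stationary : stationary S.

Let wo2 : wochoice.well_order (fun x y : T2 => (x <= y)%O) :=
  let: And3 w _ _ := T2P.2 in w.

(** A weak form of the pressing-down lemma. If all the fibers of a regressive
    map [h] were countable, each would be bounded, by [g x] say; a point [d]
    of [S] in the club of ordinals closed under [g] would lie in the fiber of
    [h d] and yet be at least [g (h d)]. *)
Lemma pressing_down (h : T2 -> T2) : (forall a, S a -> (h a < a)%O) ->
  exists x, ~ countable [set a | S a /\ h a = x].
Proof.
move=> hlt; apply: contrapT => /forallNP fib.
have /choice[g gP] : forall x, exists b, forall a, S a -> h a = x -> (a < b)%O.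
  move=> x; have [b bP] := omega2_regular_nat T2P id (contrapT (fib x)).
  by exists b => a Sa ha; exact: bP.
pose C : set T2 := [set d | forall x, (x < d)%O -> (g x <= d)%O].
have clC : closed (C : set (order_topology T2)).
  rewrite -openC openE => d /existsNP[x /not_implyP[xd /negP]].
  rewrite -ltNge => dg.
  have xg := @itv_open _ (order_topology T2) x (g x).
  rewrite /interior; apply: filterS (open_nbhs_nbhs (conj xg _)).
    move=> y /=; rewrite in_itv /= => /andP[xy yg] /(_ x xy).
    by rewrite leNgt yg.
  by rewrite /= in_itv /= xd.
have ubC : unbounded C.
  move=> b.
  have /choice[nxt nxtP] : forall y, exists z,
      forall x, (x < y)%O -> (g x < z)%O.
    move=> y; apply: (omega2_regular T2P g (A := [set x | (x < y)%O])).
    by rewrite -initial_segmentE; case: T2P => _ [].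
  have [b' b'P] :=
    omega2_regular_nat T2P id (finite_set_countable (finite_set1 b)).
  pose d n := iter n nxt b'.
  have [z zP] := omega2_regular_nat T2P d (countableP [set: nat]).
  have [|s sub smin] := wo_least wo2 (A := [set z | forall n, (d n <= z)%O]).
    by exists z => n; exact/ltW/zP.
  exists s; last exact: lt_le_trans (b'P b erefl) (sub 0%N).
  move=> x xs; have [n xn] : exists n, (x < d n)%O.
    apply: contrapT => /forallNP xd; move: xs; rewrite ltNge => /negP; apply.
    by apply: smin => n; rewrite leNgt; exact/negP.
  by apply: le_trans (sub n.+1); exact/ltW/nxtP.
have [d [Sd Cd]] := S_stationary clC ubC.
have := Cd _ (hlt d Sd); rewrite leNgt => /negP; apply; exact: gP.
Qed.

Lemma stationary_infinite : infinite_set S.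
Proof.
move=> /finite_set_countable/(omega2_regular_nat T2P id)[b bP].
have [] := @S_stationary [set` `[b, +oo[].
- exact: (@rray_closed _ (order_topology T2)).
- move=> c; have [z zP] :=
    omega2_regular_nat T2P id (finite_set_countable (finite_set2 b c)).
  exists z; last by apply: zP; right.
  by rewrite /= in_itv /= andbT; apply/ltW/zP; left.
move=> a [Sa]; rewrite /= in_itv /= andbT leNgt => /negP; apply; exact: bP.
Qed.

End pressing_down.

(** * The Stone space of the ladder algebra *)
Section ladder_algebra.
Local Open Scope ring_scope.
Context d1 (T1 : orderType d1) d2 (T2 : orderType d2).
Hypothesis T2P : is_omega2 T1 T2.
Variable (S : set T2).
Hypothesis S_stationary : stationary S.
Hypothesis S_nonreflecting : forall b : T2, has_cofinality b T1 ->
  ~ stationary [set x : predecessors b | S (val x)].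
Variable (p : T2 -> nat -> T2).
Hypothesis p_incr : forall a : T2, S a ->
  forall m n : nat, (m < n)%N -> (p a m < p a n)%O.
Hypothesis p_cvg : forall a : T2, S a ->
  (p a : nat -> order_topology T2) @ \oo --> (a : order_topology T2).

Local Notation A a := (range (p a)).
Local Notation X := (\bigcup_(a in S) A a).
Local Notation generators :=
  ([set F | finite_set F /\ F `<=` X] `|` [set A a | a in S]).
Local Notation frakA := (generated_field X generators).
Local Notation K := (ult X frakA).

Let subA a : S a -> A a `<=` X.
Proof. by move=> Sa x Ax; exists a. Qed.

Let ladderDX a : S a -> finite_set (A a `\` X).
Proof.
move=> Sa; have -> : A a `\` X = set0 by rewrite setD_eq0; exact: subA.
exact: finite_set0.
Qed.

Let generators_sub B : generators B -> B `<=` X.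
Proof. by case=> [[]//|[a Sa <-]]; exact: subA. Qed.

Let FA : field_of_sets X frakA := generated_field_of_sets generators_sub.

Let fieldC B C : frakA B -> frakA C -> frakA (B `\` C).
Proof.
move=> FB FC; have -> : B `\` C = B `&` (X `\` C).
  apply/seteqP; split => x [Bx Cx]; last by case: Cx.
  by split=> //; split => //; exact: (field_sub FA FB).
by apply: (field_setI FA) => //; exact: (field_compl FA).
Qed.

Let frakA_finite F : finite_set F -> F `<=` X -> frakA F.
Proof. by move=> fF FX; apply: generated_base; left. Qed.

Let frakA_point x : X x -> frakA [set x].
Proof. by move=> Xx; apply: frakA_finite => // _ ->. Qed.

Let frakA_ladder a : S a -> frakA (A a).
Proof. by move=> Sa; apply: generated_base; right; exists a. Qed.

Let frakA_cofinite_ladder a F : S a -> finite_set F -> frakA (A a `\` F).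
Proof.
move=> Sa fF; rewrite -[_ `\` _]set0U -(setDv (A a)) -setDIr.
apply: fieldC; first exact: frakA_ladder.
by apply: frakA_finite; [exact: finite_setIr|move=> x [Ax _]; exact: (subA Sa)].
Qed.

(** Each member of the algebra almost contains or almost misses each
    ladder. *)
Lemma ladder_split a B : S a -> frakA B ->
  finite_set (A a `\` B) \/ finite_set (A a `&` B).
Proof.
move=> Sa; move: B; apply: (generated_ind generators_sub).
- move=> B [[fF _]|[b Sb <-]]; first by right; exact: finite_setIr.
  have [->|/eqP ab] := eqVneq a b; first by left; rewrite setDv.
  by right; exact: (ladder_almost_disjoint p_incr p_cvg).
- by left; exact: ladderDX.
- move=> B FB [fB|fB]; [right|left].
    by apply: sub_finite_set fB => x [Ax [_ Bx]].
  apply: sub_finite_set fB => x [Ax nB]; split=> //; apply: contrapT => Bx.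
  by apply: nB; split => //; exact: (subA Sa).
- move=> B C _ _ [fB|fB]; last first.
    by move=> _; right; apply: sub_finite_set fB => x [Ax []].
  move=> [fC|fC]; last by right; apply: sub_finite_set fC => x [Ax []].
  by left; rewrite setDIr finite_setU.
Qed.

Lemma ladder_ultrafilter a : S a ->
  ultrafilter_of X frakA [set B | frakA B /\ finite_set (A a `\` B)].
Proof.
move=> Sa; split.
- by move=> B [].
- by split; [exact: field_top FA|exact: ladderDX].
- by move=> [_]; rewrite setD0; exact: (ladder_infinite p_incr).
- move=> B C [FB fB] [FC fC]; split; first exact: (field_setI FA).
  by rewrite setDIr finite_setU.
- move=> B C [FB fB] FC BC; split=> //; apply: sub_finite_set fB => x [Ax Cx].
  by split=> // /BC.
- move=> B FB; have [fB|fB] := ladder_split Sa FB; [by left|right].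
  split; first exact: (field_compl FA).
  apply: sub_finite_set fB => x [Ax nB]; split=> //; apply: contrapT => Bx.
  by apply: nB; split=> //; exact: (subA Sa).
Qed.

(** The ultrafilter of the sets that almost contain the ladder of [a]. *)
Definition ladder_point a (Sa : S a) : K :=
  exist _ _ (ladder_ultrafilter Sa).

Lemma principal_ultrafilter x : X x ->
  ultrafilter_of X frakA [set B | frakA B /\ B x].
Proof.
move=> Xx; split.
- by move=> B [].
- by split=> //; exact: field_top FA.
- by case.
- by move=> B C [FB Bx] [FC Cx]; split=> //; exact: (field_setI FA).
- by move=> B C [FB Bx] FC BC; split=> //; exact: BC.
- move=> B FB; have [Bx|Bx] := pselect (B x); [by left|right].
  by split=> //; exact: (field_compl FA).
Qed.

(** The isolated point of the Stone space given by an element of [X]. *)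
Definition principal_point x (Xx : X x) : K :=
  exist _ _ (principal_ultrafilter Xx).

(** Each member of the algebra almost contains all ladders but finitely many,
    or almost misses all of them but finitely many. *)
Lemma almost_all_split B : frakA B ->
  finite_set [set a | S a /\ infinite_set (A a `\` B)] \/
  finite_set [set a | S a /\ infinite_set (A a `&` B)].
Proof.
move: B; apply: (generated_ind generators_sub).
- move=> B [[fF _]|[b Sb <-]]; right.
    apply: sub_finite_set (finite_set0 _) => a [_]; apply.
    exact: finite_setIr.
  apply: sub_finite_set (finite_set1 b) => a [Sa inf] /=; apply: contrapT => ab.
  by apply: inf; exact: (ladder_almost_disjoint p_incr p_cvg).
- left; apply: sub_finite_set (finite_set0 _) => a [Sa]; apply.
  exact: ladderDX.
- move=> B FB [fB|fB]; [right|left]; apply: sub_finite_set fB => a [Sa inf];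
    split=> // fin; apply: inf; apply: sub_finite_set fin => x.
    by move=> [Ax [_ nB]].
  move=> [Ax nB]; split=> //; apply: contrapT => Bx.
  by apply: nB; split=> //; exact: (subA Sa).
- move=> B C _ _ [fB|fB]; last first.
    move=> _; right; apply: sub_finite_set fB => a [Sa inf]; split=> // fin.
    by apply: inf; apply: sub_finite_set fin => x [Ax []].
  move=> [fC|fC]; last first.
    right; apply: sub_finite_set fC => a [Sa inf]; split=> // fin.
    by apply: inf; apply: sub_finite_set fin => x [Ax []].
  left; apply: (@sub_finite_set _ _
    ([set a | S a /\ infinite_set (A a `\` B)] `|`
     [set a | S a /\ infinite_set (A a `\` C)])); last by rewrite finite_setU.
  move=> a [Sa inf]; have [fB'|iB] := pselect (finite_set (A a `\` B)).
    by right; split=> // fC'; apply: inf; rewrite setDIr finite_setU.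
  by left.
Qed.

Lemma infinity_ultrafilter : ultrafilter_of X frakA
  [set B | frakA B /\ finite_set [set a | S a /\ infinite_set (A a `\` B)]].
Proof.
split.
- by move=> B [].
- split; first exact: field_top FA.
  by apply: sub_finite_set (finite_set0 _) => a [Sa]; apply; exact: ladderDX.
- move=> [_ fin]; apply: (stationary_infinite T2P S_stationary).
  apply: sub_finite_set fin => a Sa; split=> //.
  by rewrite setD0; exact: (ladder_infinite p_incr).
- move=> B C [FB fB] [FC fC]; split; first exact: (field_setI FA).
  apply: (@sub_finite_set _ _
    ([set a | S a /\ infinite_set (A a `\` B)] `|`
     [set a | S a /\ infinite_set (A a `\` C)])); last by rewrite finite_setU.
  move=> a [Sa inf]; have [fB'|iB] := pselect (finite_set (A a `\` B)).
    by right; split=> // fC'; apply: inf; rewrite setDIr finite_setU.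
  by left.
- move=> B C [FB fB] FC BC; split=> //; apply: sub_finite_set fB => a [Sa inf].
  split=> // fin; apply: inf; apply: sub_finite_set fin => x [Ax nC].
  by split=> // /BC.
- move=> B FB; have [fB|fB] := almost_all_split FB; [by left|right].
  split; first exact: (field_compl FA).
  apply: sub_finite_set fB => a [Sa inf]; split=> // fin; apply: inf.
  apply: sub_finite_set fin => x [Ax nB]; split=> //; apply: contrapT => Bx.
  by apply: nB; split=> //; exact: (subA Sa).
Qed.

(** The remaining point of the Stone space: the ultrafilter of the sets that
    almost contain all ladders but finitely many. *)
Definition infinity_point : K := exist _ _ infinity_ultrafilter.

Lemma ladder_point_neq_infinity a (Sa : S a) :
  ladder_point Sa <> infinity_point.
Proof.
move=> E; have : sval (ladder_point Sa) (A a).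
  by split; [exact: frakA_ladder|rewrite setDv].
rewrite E => -[_ fin]; apply: (stationary_infinite T2P S_stationary).
have : finite_set ([set b | S b /\ infinite_set (A b `\` A a)] `|` [set a]).
  by rewrite finite_setU.
apply: sub_finite_set => b Sb.
have [->|/eqP ba] := eqVneq b a; [by right|left; split=> // fD].
apply: (ladder_infinite p_incr Sb); rewrite -(setUIDK (A b) (A a)).
rewrite finite_setU; split=> //.
exact: (ladder_almost_disjoint p_incr p_cvg).
Qed.

Lemma nbhs_ladder_point a (Sa : S a) (V : set K) : nbhs (ladder_point Sa) V ->
  exists n (Xn : X (p a n)), V (principal_point Xn).
Proof.
move=> /ult_nbhsP[B [FB fin] BV].
have [n Bn] : exists n, B (p a n).
  apply: contrapT => /forallNP nB; apply: (ladder_infinite p_incr Sa).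
  by apply: sub_finite_set fin => _ [n _ <-]; split; [exists n|exact: nB].
have Xn : X (p a n) by exists a => //; exists n.
by exists n, Xn; apply: BV.
Qed.

Lemma nbhs_infinity_point (V : set K) : nbhs infinity_point V ->
  finite_set [set a | exists Sa : S a, ~ V (ladder_point Sa)].
Proof.
move=> /ult_nbhsP[B [FB fin] BV]; apply: sub_finite_set fin => a [Sa nV].
by split=> // fD; apply: nV; exact: BV.
Qed.

(** Given an embedding into a sigma-product, choose for each [a] in [S] a
    coordinate [i] and an integer [m] such that the point of [a] and the point
    at infinity are more than [1 / (m + 1)] apart at [i], then a member [x] of
    the ladder of [a] whose point differs from infinity at [i]. By pressing
    down, uncountably many [a] share the same [x]. But [i] then ranges over
    the countable union of two supports, and each pair [(i, m)] occurs for
    finitely many [a], as the points of the ladders converge to infinity. *)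
Lemma not_corson (R : realType) : ~ corson_compact R K.
Proof.
move=> [_ [I [Z [Zsigma [f [g [fc _ fK _]]]]]]].
pose F u i : R := (set_val (f u) : {ptws I -> R}) i.
have Fc i : continuous (fun u => F u i).
  move=> u; apply: (@continuous_comp K {ptws I -> R} R
    (fun u => set_val (f u)) (fun h => h i)); last first.
    exact: ptws_eval_continuous.
  apply: (@continuous_comp K Z {ptws I -> R} f set_val); first exact: fc.
  exact: initial_continuous.
have Fsupp u : countable [set i | F u i != 0] by exact/Zsigma/set_valP.
have Finj u v : (forall i, F u i = F v i) -> u = v.
  move=> uv; apply: (can_inj fK); apply: val_inj; apply/funext => i.
  exact: uv.
(* The point at infinity need not be sent to the zero family, whence the second
   support. *)
pose supp x : set I := [set i | exists Xx : X x, F (principal_point Xx) i != 0]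
  `|` [set i | F infinity_point i != 0].
have suppc x : countable (supp x).
  have [Xx|nX] := pselect (X x); last first.
    apply: sub_countable (Fsupp infinity_point); apply: subset_card_le.
    by move=> i [[Xx]|//]; case: nX.
  have -> : supp x = \bigcup_(b in [set: bool])
     [set i | F (if b then principal_point Xx else infinity_point) i != 0].
    apply/seteqP; split => i /=.
      move=> [[Xx' h]|h]; [exists true|exists false] => //.
      by rewrite (Prop_irrelevance Xx Xx').
    by move=> [[] _ h]; [left; exists Xx|right].
  by apply: bigcup_countable => [|b _]; [exact: countableP|exact: Fsupp].
have main a : exists t : T2 * I * nat, S a ->
    [/\ A a t.1.1, supp t.1.1 t.1.2 &
      exists Sa : S a, t.2.+1%:R^-1 <
        `|F infinity_point t.1.2 - F (ladder_point Sa) t.1.2| ].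
  have [Sa|nS] := pselect (S a); last first.
    have [i _] : [set: I] !=set0.
      apply/set0P/eqP => I0.
      have [b Sb] := infinite_setN0 (stationary_infinite T2P S_stationary).
      apply: (@ladder_point_neq_infinity b Sb); apply: Finj => i.
      by have : [set: I] i by []; rewrite I0.
    by exists (a, i, 0%N).
  have [i Fi] : exists i, F (ladder_point Sa) i <> F infinity_point i.
    apply: contrapT => /forallNP Fi; apply: (@ladder_point_neq_infinity a Sa).
    by apply: Finj => i; exact: contrapT (Fi i).
  have [n [Xn Fn]] : exists n (Xn : X (p a n)),
      F (principal_point Xn) i != F infinity_point i.
    apply: (@nbhs_ladder_point a Sa [set u | F u i != F infinity_point i]).
    have := @open_nbhs_nbhs R (F (ladder_point Sa) i)
      [set r | r != F infinity_point i].
    move=> /(_ _)/(Fc i); apply; split; last exact/eqP.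
    exact: open_neq.
  have d0 : 0 < `|F infinity_point i - F (ladder_point Sa) i|.
    by rewrite normr_gt0 subr_eq0 eq_sym; exact/eqP.
  pose m := Num.Def.truncn `|F infinity_point i - F (ladder_point Sa) i|^-1.
  exists (p a n, i, m) => _.
  split => /=; first by exists n.
    have [F0|F0] := eqVneq (F infinity_point i) 0; last by right.
    by left; exists Xn; rewrite -F0.
  exists Sa; rewrite invf_plt ?posrE//; exact: truncnS_gt.
have [t tP] := choice main.
have [|x] := pressing_down T2P S_stationary (h := fun a => (t a).1.1).
  move=> a Sa; have [[n _ <-] _ _] := tP a Sa.
  exact: (ladder_lt p_incr p_cvg).
apply.
apply: (@sub_countable _ _ _ (\bigcup_(im in supp x `*` [set: nat])
  [set a | exists Sa : S a,
     ~ `|F infinity_point im.1 - F (ladder_point Sa) im.1| < im.2.+1%:R^-1])).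
  apply: subset_card_le => a [Sa ax].
  have [_ ta [Sa' lt]] := tP a Sa; rewrite ax in ta.
  exists ((t a).1.2, (t a).2) => //=; exists Sa'.
  by apply/negP; rewrite -leNgt ltW.
apply: bigcup_countable; first exact: countableX.
move=> [i m] _ /=; apply: finite_set_countable.
apply: (@nbhs_infinity_point
  [set u | `|F infinity_point i - F u i| < m.+1%:R^-1]).
have /cvgrPdist_lt := Fc i infinity_point; apply.
by rewrite invr_gt0.
Qed.

(** The set [Y] only involves elements and ladders up to some [b], and so does
    its closure. On it, singletons and the ladders up to [b], made disjoint,
    give a separating clopen family such that each point lies in at most two
    of its members. *)
Lemma closure_eberlein (R : realType) (Y : set K) :
  (Y #<= [set: T1])%card -> uniform_eberlein_compact R (closure Y).
Proof.
move=> YT1.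
(* [r y] is the ordinal that [y] involves: the element that generates [y], or
   the index of the ladder that belongs to [y], if there is any. *)
have /choice[r rP] : forall y : K, exists x : T2,
    (forall z, sval y [set z] -> x = z) /\
    ((~ exists z, sval y [set z]) -> forall a, S a -> sval y (A a) -> x = a).
  move=> y; have [[z yz]|ny] := pselect (exists z, sval y [set z]).
    exists z; split=> [w yw|[]]; last by exists z.
    by have := ult_principal_mem yz yw.
  have [[a [Sa ya]]|na] := pselect (exists a, S a /\ sval y (A a)); last first.
    have [b _] := infinite_setN0 (stationary_infinite T2P S_stationary).
    exists b; split=> [w yw|_ a Sa ya]; first by case: ny; exists w.
    by case: na; exists a.
  exists a; split=> [w yw|_ b Sb yb]; first by case: ny; exists w.
  apply: contrapT => ab.
  apply: (ult_nonprincipal_finite FA frakA_point ny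
    (ladder_almost_disjoint p_incr p_cvg Sa Sb ab)).
  exact: (ult_setI (svalP y)).
have [b bP] := omega2_regular T2P r YT1.
have closure_high u a : closure Y u -> S a -> (b < a)%O -> sval u (A a) ->
    exists x, sval u [set x].
  move=> Yu Sa ba ua; apply: contrapT => nu.
  pose F := [set y | A a y /\ (y <= b)%O].
  have fF : finite_set F by exact: (ladder_finite_le p_cvg).
  have FX : F `<=` X by move=> x [Ax _]; exact: (subA Sa).
  have uB : sval u (A a `&` (X `\` F)).
    apply: (ult_setI (svalP u)) => //; apply: ult_complN.
      exact: frakA_finite.
    exact: (ult_nonprincipal_finite FA frakA_point nu).
  have [|y [Yy yB]] := Yu (@basic _ X frakA (A a `&` (X `\` F))).
    by apply/ult_nbhsP; exists (A a `&` (X `\` F)).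
  have [[x yx]|ny] := pselect (exists x, sval y [set x]).
    have [Ax [_ nF]] := ult_principal_mem yx yB.
    apply: nF; split => //; rewrite -((rP y).1 x yx).
    exact/ltW/bP.
  have ya : sval y (A a).
    by apply: (ult_up (svalP y) yB); [exact: frakA_ladder|move=> x []].
  have := bP y Yy; rewrite ((rP y).2 ny a Sa ya) => ab.
  by have := lt_trans ab ba; rewrite ltxx.
have [F [Ffin Fdisj]] := disjointify_le T2P S_nonreflecting p_incr p_cvg b.
pose E (i : T2 + T2) : set K := match i with
  | inl x => @basic _ X frakA [set x]
  | inr a => if pselect (S a /\ (a <= b)%O) then @basic _ X frakA (A a `\` F a)
             else set0
  end.
have clE i : clopen (E i).
  case: i => [x|a] /=; first exact: basic_clopen.
  case: pselect => [Sab|nSab]; first exact: basic_clopen.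
  by split; [exact: open0|exact: closed0].
have val_cont : continuous (set_val : closure Y -> K).
  exact: initial_continuous.
apply: (@eberlein_criterion R (T2 + T2)%type (closure Y)
  (fun i => set_val @^-1` E i) 2).
- move=> i; have [oE cE] := clE i; split.
    by move/continuousP: val_cont; apply.
  by move/continuous_closedP: val_cont; apply.
- (* At most one singleton and one of the disjoint sets belong to [u]. *)
  move=> u B BE; pose s (i : T2 + T2) := if i is inl _ then true else false.
  have sinj : {in B &, injective s}.
    move=> [x|a] [x'|a'] /BE /= ux /BE /= ux' //= _.
      by congr inl; have := ult_principal_mem ux ux'.
    move: ux ux'; case: pselect => // -[Sa ab]; case: pselect => // -[Sa' a'b].
    move=> ua ua'; congr inr; apply: contrapT => aa'.
    exact: (ult_disjoint ua ua' (Fdisj _ _ Sa Sa' ab a'b aa')).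
  rewrite -(card_in_imfset imfset_key sinj) -(cardfs2 true false).
  by apply: fsubset_leq_card; apply/fsubsetP => -[] _; rewrite !inE.
- move=> u v uv; apply: val_inj; apply: ult_eq.
  have uvx x : sval (val u) [set x] <-> sval (val v) [set x] := uv (inl x).
  have [[x ux]|nu] := pselect (exists x, sval (val u) [set x]).
    have vx := (uvx x).1 ux => B FB.
    by rewrite (ult_principal FB ux) (ult_principal FB vx).
  have nv : ~ exists x, sval (val v) [set x].
    by move=> [x vx]; apply: nu; exists x; exact/uvx.
  have fin (w : K) B :
      (~ exists x, sval w [set x]) -> finite_set B -> ~ sval w B.
    by move=> nw; exact: (ult_nonprincipal_finite FA frakA_point nw).
  have lad (w : K) a : (~ exists x, sval w [set x]) -> S a -> (a <= b)%O ->
      sval w (A a) <-> sval w (A a `\` F a).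
    move=> nw Sa ab; split=> [wA|wA]; last first.
      by apply: (ult_up (svalP w) wA); [exact: frakA_ladder|move=> x []].
    apply: contrapT => nA.
    have fF : finite_set (F a) by exact: Ffin.
    apply: (fin w (A a `&` F a) nw); first exact: finite_setIr.
    rewrite -setDD; have := ult_complN (frakA_cofinite_ladder Sa fF) nA.
    move=> /(ult_setI (svalP w) wA) /(ult_up (svalP w)); apply.
      by apply: fieldC; [exact: frakA_ladder|exact: frakA_cofinite_ladder].
    by move=> x [Ax [_ h]].
  apply: (generated_ind generators_sub).
  + move=> B [[fB _]|[a Sa <-]]; first by split=> /fin; case.
    have [ab|ba] := leP a b.
      rewrite !lad//; have := uv (inr a); rewrite /= /E.
      by case: pselect => // -[].
    split=> h; exfalso.
      by apply: nu; exact: closure_high (set_valP u) Sa ba h.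
    by apply: nv; exact: closure_high (set_valP v) Sa ba h.
  + by split=> _; exact: (ult_top (svalP _)).
  + have sub (w z : K) B : frakA B -> (sval w B <-> sval z B) ->
        sval w (X `\` B) -> sval z (X `\` B).
      move=> FB wz wB; apply: ult_complN => // /wz wB'.
      by apply: (ult_disjoint wB' wB); rewrite setDIK.
    by move=> B FB uvB; split; apply: sub => //; apply: iff_sym.
  + have sub (w : K) B C : frakA B -> frakA C ->
        sval w (B `&` C) <-> (sval w B /\ sval w C).
      move=> FB FC; split; last by move=> [wB wC]; exact: (ult_setI (svalP w)).
      by move=> wBC; split; apply: (ult_up (svalP w) wBC) => // x [].
    by move=> B C FB FC uB uC; rewrite !sub// uB uC.
- apply: compact_set_type; apply: subclosed_compact (ult_compact FA) _ => //.
  exact: closed_closure.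
- apply: (hausdorff_injection val_cont); first exact: val_inj.
  exact: (@ult_hausdorff _ X frakA).
Qed.

End ladder_algebra.

Theorem corollary3p9 (R : realType)
    (d1 : Order.disp_t) (omega1 : orderType d1)
    (d2 : Order.disp_t) (omega2 : orderType d2)
    (omega2P : is_omega2 omega1 omega2)
    (S : set omega2)
    (S_stationary : stationary S)
    (S_cof : forall a : omega2, S a -> has_cofinality a nat)
    (S_nonreflecting : forall b : omega2, has_cofinality b omega1 ->
       ~ stationary [set x : predecessors b | S (val x)])
    (p : omega2 -> nat -> omega2)
    (p_incr : forall a : omega2, S a ->
       forall m n : nat, (m < n)%N -> (p a m < p a n)%O)
    (p_cvg : forall a : omega2, S a ->
       (p a : nat -> order_topology omega2) @ \oo --> (a : order_topology omega2)) :
  let A (a : omega2) : set omega2 := range (p a) in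
  let X : set omega2 := \bigcup_(a in S) A a in
  let frakA : set_system omega2 :=
    generated_field X
      ([set F | finite_set F /\ F `<=` X] `|` [set A a | a in S]) in
  let K : topologicalType := ult X frakA in
  ~ corson_compact R K /\
  (forall Y : set K, Y #<= [set: omega1] ->
     uniform_eberlein_compact R (closure Y)).
Proof.
split; first exact: (not_corson omega2P S_stationary p_incr p_cvg).
exact: (closure_eberlein omega2P S_stationary S_nonreflecting p_incr p_cvg).
Qed.
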